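(* Let $p\in(1,\infty)$. Every algebra homomorphism from $\mathscr{B}(\mathcal{J}_p(\omega_1))$ into a Banach algebra is automatically continuous.
   Context: Scalars: $\mathbb{K}=\mathbb{R}$ or $\mathbb{C}$. For $x\colon[0,\omega_1)\to\mathbb{K}$ put $\|x\|_{p,0}=\sup\big(\sum_{j=1}^n|x(\alpha_j)-x(\alpha_{j-1})|^p\big)^{1/p}$, the supremum over $n\in\mathbb{N}$ and $0\leqslant\alpha_0<\dots<\alpha_n<\omega_1$. The long James space $\mathcal{J}_p(\omega_1)$ is the Banach space (under $\|\cdot\|_{p,0}$ or an equivalent norm) of continuous functions $x\colon[0,\omega_1)\to\mathbb{K}$ with $\lim_{\alpha\to\omega_1}x(\alpha)=0$ and $\|x\|_{p,0}<\infty$. $\mathscr{B}(\mathcal{J}_p(\omega_1))$ is the Banach algebra of bounded operators on it. Homomorphisms are linear and multiplicative, with no continuity assumed. *)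

(* Defs.v *)
From HB Require Import structures.
From mathcomp Require Import all_boot all_order all_algebra.
From mathcomp Require Import complex.
From mathcomp Require Import all_classical all_reals all_analysis.
From mathcomp Require Import wochoice ring.

Set Implicit Arguments.
Unset Strict Implicit.
Unset Printing Implicit Defensive.

Import Order.TTheory GRing.Theory Num.Theory.
Import numFieldNormedType.Exports.

Local Open Scope classical_set_scope.
Local Open Scope ring_scope.

Variant scalar_kind := RealScalars | ComplexScalars.

Definition scalar_field (R : realType) (k : scalar_kind) : numFieldType :=
  match k with
  | RealScalars => R
  | ComplexScalars => R[i]
  end.

(* MathComp norms take their values in the scalar field itself, so the two
   maps below mediate between that field and R. *)
Definition modulus (R : realType) (k : scalar_kind) : scalar_field R k -> R :=
  match k with
  | RealScalars => fun x : R => `|x|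
  | ComplexScalars => fun z : R[i] => complex.Re `|z|
  end.

Definition of_real (R : realType) (k : scalar_kind) : R -> scalar_field R k :=
  match k with
  | RealScalars => fun x : R => x
  | ComplexScalars => fun x : R => x%:C%C
  end.
Arguments of_real {R} k _.

Section ScalarTheory.
Context {R : realType} {k : scalar_kind}.
Implicit Types (z : scalar_field R k) (r : R).

Lemma of_real_modulus z : of_real k (modulus z) = `|z|.
Proof. by case: k z. Qed.

Lemma modulus_ge0 z : 0 <= modulus z.
Proof. by case: k z => /= [x|[a b]]; [exact: normr_ge0|exact: sqrtr_ge0]. Qed.

Lemma of_realD r s : of_real k (r + s) = of_real k r + of_real k s.
Proof. by case: k => //=; rewrite rmorphD. Qed.

Lemma of_realM r s : of_real k (r * s) = of_real k r * of_real k s.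
Proof. by case: k => //=; rewrite rmorphM. Qed.

Lemma of_real_le r s : (of_real k r <= of_real k s) = (r <= s).
Proof. by case: k => //=; rewrite lecR. Qed.

Lemma of_real0 : of_real k (0 : R) = 0.
Proof. by case: k. Qed.

Lemma of_real1 : of_real k (1 : R) = 1.
Proof. by case: k. Qed.

Lemma of_real_inj : injective (of_real k : R -> scalar_field R k).
Proof. by case: k => //= x y []. Qed.

Lemma modulus_of_real r : 0 <= r -> modulus (of_real k r) = r.
Proof.
move=> r0; apply: of_real_inj; rewrite of_real_modulus ger0_norm//.
by rewrite -of_real0 of_real_le.
Qed.

Lemma modulus_normr z : modulus `|z| = modulus z.
Proof. by rewrite -of_real_modulus modulus_of_real// modulus_ge0. Qed.

Lemma le_modulus z1 z2 : `|z1| <= `|z2| -> modulus z1 <= modulus z2.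
Proof. by rewrite -!of_real_modulus of_real_le. Qed.

Lemma modulusD z1 z2 : modulus (z1 + z2) <= modulus z1 + modulus z2.
Proof. by rewrite -of_real_le of_realD !of_real_modulus ler_normD. Qed.

Lemma modulusM z1 z2 : modulus (z1 * z2) = modulus z1 * modulus z2.
Proof. by apply: of_real_inj; rewrite of_realM !of_real_modulus normrM. Qed.

Lemma modulus0 : modulus (0 : scalar_field R k) = 0.
Proof. by apply: of_real_inj; rewrite of_real_modulus normr0 of_real0. Qed.

Lemma modulus_eq0 z : modulus z = 0 -> z = 0.
Proof.
by move=> z0; apply/eqP; rewrite -normr_eq0 -of_real_modulus z0 of_real0.
Qed.

End ScalarTheory.

(* Multiplication is not assumed to have a unit, unlike that of GRing. *)
HB.mixin Record NormedModule_isNormedAlgebra (K : numFieldType) A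
    & NormedModule K A := {
  amul : A -> A -> A ;
  amulA : associative amul ;
  amulDl : left_distributive amul +%R ;
  amulDr : right_distributive amul +%R ;
  amulZl : forall (c : K) (a b : A), amul (c *: a) b = c *: amul a b ;
  amulZr : forall (c : K) (a b : A), amul a (c *: b) = c *: amul a b ;
  amul_norm : forall a b : A, `|amul a b| <= `|a| * `|b|
}.

#[short(type="normedAlgType")]
HB.structure Definition NormedAlgebra (K : numFieldType) :=
  {A of NormedModule K A & NormedModule_isNormedAlgebra K A}.

#[short(type="banachAlgType")]
HB.structure Definition BanachAlgebra (K : numFieldType) :=
  {A of NormedAlgebra K A & CompleteNormedModule K A}.

Definition bounded_linear (K : numFieldType) (X Y : normedModType K) :
    {pred X -> Y} :=
  mem [set f : X -> Y | linear f /\ exists M, forall x, `|f x| <= M * `|x|].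
Arguments bounded_linear {K} X Y.

Section BoundedOperators.
Context {R : realType} {k : scalar_kind}.
Local Notation K := (scalar_field R k).
Context {X : normedModType K}.

Lemma bounded_linearP (f : X -> X) : f \in bounded_linear X X <->
  linear f /\ exists M, forall x, `|f x| <= M * `|x|.
Proof. by rewrite inE. Qed.

Lemma bounded_linear_submod_closed : submod_closed (bounded_linear X X).
Proof.
split.
  apply/bounded_linearP; split; first by move=> a u v /=; rewrite scaler0 addr0.
  by exists 0 => x; rewrite mul0r normr0.
move=> a f g /bounded_linearP[lf [Mf bf]] /bounded_linearP[lg [Mg bg]].
apply/bounded_linearP; split.
  move=> c u v; rewrite !fctE lf lg !scalerDr !scalerA [a * c]mulrC.
  by rewrite addrACA.
exists (`|a| * Mf + Mg) => x; rewrite mulrDl -mulrA.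
rewrite (le_trans (ler_normD _ _))// lerD//.
by rewrite !fctE normrZ ler_wpM2l.
Qed.

HB.instance Definition _ := GRing.isSubmodClosed.Build _ _ (bounded_linear X X)
  bounded_linear_submod_closed.

End BoundedOperators.

Record bounded_operator (R : realType) (k : scalar_kind)
    (X : normedModType (scalar_field R k)) := BoundedOperator {
  bop_fun :> X -> X ;
  _ : bop_fun \in bounded_linear X X }.

Section BoundedOperatorAlgebra.
Context {R : realType} {k : scalar_kind}.
Local Notation K := (scalar_field R k).
Context {X : normedModType K}.
Local Notation B := (bounded_operator X).
Implicit Types S T U : B.

HB.instance Definition _ := [isSub for @bop_fun R k X].
HB.instance Definition _ := [Choice of B by <:].
HB.instance Definition _ := [SubChoice_isSubLmodule of B by <:].

Definition operator_norm (T : B) : K :=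
  of_real k (sup [set modulus `|T x| | x in [set x : X | `|x| <= 1]]).

Lemma bop_linear (T : B) : linear T.
Proof. by case: T => f fP; have /bounded_linearP[] := fP. Qed.

HB.instance Definition _ (T : B) :=
  GRing.isLinear.Build K X X *:%R (bop_fun T) (bop_linear T).

Lemma bopDE (S T : B) x : (S + T) x = S x + T x. Proof. by []. Qed.

Lemma bopZE (c : K) (T : B) x : (c *: T) x = c *: T x. Proof. by []. Qed.

Lemma bopP (S T : B) : S =1 T -> S = T.
Proof. by move=> ST; exact/val_inj/funext. Qed.

Let image (T : B) := [set modulus `|T x| | x in [set x : X | `|x| <= 1]].

Let image_has_sup T : has_sup (image T).
Proof.
case: T => f fP; have /bounded_linearP[_ [M fM]] := fP; split.
  by exists (modulus `|f 0|), 0 => //=; rewrite normr0 ler01.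
exists (modulus M) => _ [x /= x1 <-].
apply: le_modulus; rewrite normr_id; apply: le_trans (fM x) _.
have [->|x0] := eqVneq x 0; first by rewrite normr0 mulr0.
have M0 : 0 <= M.
  by rewrite -(@pmulr_lge0 _ `|x|) ?normr_gt0//; apply: le_trans (fM x).
by rewrite ger0_norm// ler_piMr.
Qed.

Lemma operator_norm_ge0 T : 0 <= operator_norm T.
Proof.
rewrite -of_real0 of_real_le; have [[r Tr] ub] := image_has_sup T.
apply: le_trans (ub_le_sup ub Tr); case: Tr => x _ <-.
exact: modulus_ge0.
Qed.

Lemma le_operator_norm T x : `|T x| <= operator_norm T * `|x|.
Proof.
have [->|x0] := eqVneq x 0; first by rewrite linear0 !normr0 mulr0.
have nx0 : 0 < `|x| by rewrite normr_gt0.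
rewrite -ler_pdivrMr//.
have -> : `|T x| / `|x| = `|T (`|x|^-1 *: x)|.
  by rewrite linearZ normrZ ger0_norm ?invr_ge0// mulrC.
set y := _ *: x; rewrite -[leLHS]normr_id -of_real_modulus of_real_le.
have [_ ub] := image_has_sup T; apply: (ub_le_sup ub); exists y => //=.
by rewrite /y normrZ ger0_norm ?invr_ge0// mulVf// gt_eqF.
Qed.

Lemma operator_norm_le T (M : K) : 0 <= M ->
  (forall x, `|T x| <= M * `|x|) -> operator_norm T <= M.
Proof.
move=> M0 TM; rewrite -[leRHS]ger0_norm// -of_real_modulus of_real_le.
apply: ge_sup; first by case: (image_has_sup T).
move=> _ [x /= x1 <-]; apply: le_modulus; rewrite normr_id ger0_norm//.
by apply: le_trans (TM x) _; rewrite ler_piMr.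
Qed.

Lemma operator_normD S T :
  operator_norm (S + T) <= operator_norm S + operator_norm T.
Proof.
apply: operator_norm_le => [|x]; first by rewrite addr_ge0 ?operator_norm_ge0.
rewrite bopDE mulrDl (le_trans (ler_normD _ _))//.
by rewrite lerD ?le_operator_norm.
Qed.

Lemma operator_normZ (c : K) T :
  operator_norm (c *: T) = `|c| * operator_norm T.
Proof.
have le_Z a S : operator_norm (a *: S) <= `|a| * operator_norm S.
  apply: operator_norm_le => [|x]; first by rewrite mulr_ge0 ?operator_norm_ge0.
  by rewrite bopZE normrZ -mulrA ler_wpM2l ?le_operator_norm.
apply/eqP; rewrite eq_le le_Z/=.
have [->|c0] := eqVneq c 0; first by rewrite normr0 mul0r operator_norm_ge0.
rewrite -ler_pdivlMl ?normr_gt0// -normfV (le_trans _ (le_Z _ _))//.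
by rewrite scalerA mulVf// scale1r.
Qed.

Lemma operator_norm0_eq0 T : operator_norm T = 0 -> T = 0.
Proof.
move=> T0; apply: bopP => x; apply/eqP; rewrite -normr_le0.
by rewrite (le_trans (le_operator_norm T x))// T0 mul0r.
Qed.

HB.instance Definition _ := Lmodule_isNormed.Build K B
  operator_normD operator_normZ operator_norm0_eq0.

Lemma comp_bounded_linear (S T : B) : S \o T \in bounded_linear X X.
Proof.
apply/bounded_linearP; split; first by move=> a u v /=; rewrite !linearP.
exists (operator_norm S * operator_norm T) => x.
rewrite (le_trans (le_operator_norm _ _))// -mulrA.
by rewrite ler_wpM2l ?operator_norm_ge0 ?le_operator_norm.
Qed.

Definition comp_operator (S T : B) : B := BoundedOperator (comp_bounded_linear S T).

Fact comp_operatorA : associative comp_operator.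
Proof. by move=> S T U; exact: bopP. Qed.

Fact comp_operatorDl : left_distributive comp_operator +%R.
Proof. by move=> S T U; exact: bopP. Qed.

Fact comp_operatorDr : right_distributive comp_operator +%R.
Proof. by move=> S T U; apply: bopP => x; rewrite bopDE /= linearD. Qed.

Fact comp_operatorZl (c : K) S T :
  comp_operator (c *: S) T = c *: comp_operator S T.
Proof. exact: bopP. Qed.

Fact comp_operatorZr (c : K) S T :
  comp_operator S (c *: T) = c *: comp_operator S T.
Proof. by apply: bopP => x; rewrite bopZE /= linearZ. Qed.

Fact norm_comp_operator (S T : B) : `|comp_operator S T| <= `|S| * `|T|.
Proof.
rewrite -[leLHS]/(operator_norm _) -[leRHS]/(operator_norm S * operator_norm T).
apply: operator_norm_le => [|x]; first by rewrite mulr_ge0 ?operator_norm_ge0.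
rewrite (le_trans (le_operator_norm S _))// -mulrA.
by rewrite ler_wpM2l ?operator_norm_ge0 ?le_operator_norm.
Qed.

HB.instance Definition _ := NormedModule_isNormedAlgebra.Build K B
  comp_operatorA comp_operatorDl comp_operatorDr
  comp_operatorZl comp_operatorZr norm_comp_operator.

End BoundedOperatorAlgebra.

(* A type ordered like the ordinal interval [0, omega_1), that is, like the
   first uncountable ordinal, with its order topology. *)
HB.mixin Record OrderTopological_isOmega1 d W & OrderTopological d W := {
  omega1_min : forall A : set W, A !=set0 ->
    exists2 a, A a & forall b, A b -> (a <= b)%O ;
  omega1_segment : forall a : W, countable [set b : W | (b < a)%O] ;
  omega1_uncountable : ~ countable [set: W]
}.

#[short(type="omega1Type")]
HB.structure Definition Omega1 d :=
  {W of OrderTopological d W & OrderTopological_isOmega1 d W}.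

Section Omega1Theory.
Context {d : Order.disp_t} {W : omega1Type d}.

Lemma omega1_unbounded (a : W) : exists b, (a < b)%O.
Proof.
apply: contrapT => /forallNP noub; apply: (@omega1_uncountable d W).
have -> : [set: W] = [set b | (b < a)%O] `|` [set a].
  apply/seteqP; split=> // b _; have [ba|ab|->] := ltgtP b a.
  - by left.
  - by case: (noub b).
  - by right.
rewrite -bigcup2E; apply: bigcup_countable => // -[|[|i]] _ /=.
- exact: omega1_segment.
- exact: countable1.
- exact: countable0.
Qed.

Lemma omega1_inhabited : [set: W] !=set0.
Proof.
by apply/set0P/eqP => W0; apply: (@omega1_uncountable d W); rewrite W0.
Qed.

(* The neighbourhoods of the missing end point: convergence along this filter
   is convergence as alpha tends to omega_1. *)
Definition at_omega1 : set_system W :=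
  filter_from [set: W] (fun a => [set b | (a < b)%O]).

Global Instance at_omega1_filter : ProperFilter at_omega1.
Proof.
apply: filter_from_proper => [|a _]; last first.
  by have [b ab] := omega1_unbounded a; exists b.
apply: filter_from_filter => [|a b _ _].
  by have [a _] := omega1_inhabited; exists a.
by exists (Order.max a b) => // c /=; rewrite gt_max => /andP[].
Qed.

End Omega1Theory.

(* The ordinal omega_1 realised inside a well-ordering of the continuum: the
   elements with countably many predecessors. It shows that omega1Type is
   inhabited. *)
Section Omega1Exists.

Definition wo_rel : rel (set nat) := sval (well_ordering_principle (set nat)).

Let wo : well_order wo_rel.
Proof. exact: (svalP (well_ordering_principle (set nat))). Qed.

Let wo_min (P : set (set nat)) : P !=set0 ->
  exists2 z, P z & forall x, P x -> wo_rel z x.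
Proof.
move=> [x Px]; have [|z [[zP zlb] _]] := @wo (mem P).
  by exists x; rewrite inE.
exists z; first by move: zP; rewrite inE.
by move=> y Py; apply: zlb; rewrite inE.
Qed.

Let wo_refl : reflexive wo_rel.
Proof. by move=> x; have [z -> ->] := @wo_min [set x] (ex_intro _ x erefl). Qed.

Let wo_anti : antisymmetric wo_rel.
Proof.
move=> x y /andP[xy yx].
have [|z [_ zuniq]] := @wo (mem [set x; y]).
  by exists x; rewrite inE; left.
rewrite -(zuniq x) ?(zuniq y)//; split=> [|u]; rewrite inE.
- by right.
- by move=> [->|->].
- by left.
- by move=> [->|->].
Qed.

Let wo_total : total wo_rel.
Proof.
move=> x y; have [|z [->|->] zlb] := @wo_min [set x; y].
- by exists x; left.
- by rewrite zlb//; right.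
- by rewrite (zlb x) ?orbT//; left.
Qed.

Let wo_trans : transitive wo_rel.
Proof.
move=> y x z xy yz; have [|t [[->|->]|->] tlb] := @wo_min [set x; y; z].
- by exists x; left; left.
- by apply: tlb; right.
- have /wo_anti -> // : wo_rel x y && wo_rel y x.
  by rewrite xy tlb//; left; left.
- have zy : wo_rel z y by apply: tlb; left; right.
  have <- : y = z by apply: wo_anti; rewrite yz.
  exact: xy.
Qed.

Definition wo_segment (x : set nat) := [set y | y != x /\ wo_rel y x].

Record omega1_carrier := Omega1Carrier {
  omega1_val : set nat ;
  _ : countable (wo_segment omega1_val) }.

HB.instance Definition _ := [isSub for omega1_val].
HB.instance Definition _ := [Choice of omega1_carrier by <:].

Let le (u v : omega1_carrier) := wo_rel (val u) (val v).
Let lt (u v : omega1_carrier) := (v != u) && le u v.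

Fact omega1_display : Order.disp_t. Proof. exact: Order.Disp. Qed.

Let le_anti : antisymmetric le.
Proof. by move=> u v uv; exact/val_inj/wo_anti. Qed.

HB.instance Definition _ := @Order.isPOrder.Build omega1_display omega1_carrier
  le lt (fun _ _ => erefl) (fun u => wo_refl (val u)) le_anti
  (fun v u w => @wo_trans (val v) (val u) (val w)).

HB.instance Definition _ :=
  Order.POrder_isTotal.Build omega1_display omega1_carrier
    (fun u v => wo_total (val u) (val v)).

Definition omega1 := order_topology omega1_carrier.

HB.instance Definition _ := OrderTopological.on omega1.


Let carrierP (x : omega1_carrier) : countable (wo_segment (val x)).
Proof. by case: x. Qed.

Let omega1_minE (A : set omega1) : A !=set0 ->
  exists2 a, A a & forall b, A b -> (a <= b)%O.
Proof.
move=> [a Aa]; have [|_ [z Az <-] zlb] := @wo_min (val @` A).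
  by exists (val a), a.
by exists z => // b Ab; apply: zlb; exists b.
Qed.

Let omega1_segmentE (a : omega1) : countable [set b : omega1 | (b < a)%O].
Proof.
have /countable_injP[f finj] := carrierP a.
apply/countable_injP; exists (f \o val) => b c; rewrite !inE /= => ba ca fbc.
have seg (u : omega1) : (u < a)%O -> val u \in wo_segment (val a).
  by rewrite lt_neqAle inE => /andP[].
by apply/val_inj/finj => //; exact: seg.
Qed.

Let omega1_uncountableE : ~ countable [set: omega1].
Proof.
move=> /countable_injP[f finj].
have inW (x : set nat) : countable (wo_segment x) ->
  exists u : omega1_carrier, val u = x.
  by move=> xc; exists (Omega1Carrier xc).
have cnt (A : set (set nat)) :
    (forall x, A x -> countable (wo_segment x)) -> countable A.
  move=> AW; pose g x := if pselect (exists u : omega1_carrier, val u = x) is left e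
    then f (sval (cid e)) else 0%N.
  apply/countable_injP; exists g => x y; rewrite !inE => Ax Ay; rewrite /g.
  case: pselect => [e|]; last by case; exact/inW/AW.
  case: pselect => [e'|]; last by case; exact/inW/AW.
  case: (cid e) (cid e') => u /= <- [v /= <-] /finj uv.
  by rewrite uv ?inE.
have [x xN] : exists x, ~ countable (wo_segment x).
  apply/existsNP => all; have /countable_injP[g ginj] := cnt setT (fun x _ => all x).
  pose D := [set n | exists2 x, g x = n & ~ x n].
  have DN : ~ D (g D).
    by move=> DD; case: (DD) => x /(ginj x D (in_setT _) (in_setT _)) ->.
  by apply: (DN); exists D.
have [z zN zlb] := @wo_min [set x | ~ countable (wo_segment x)] (ex_intro _ x xN).
apply: zN; apply: cnt => y [yz yz'].
apply: contrapT => /zlb zy; move/eqP: yz; apply.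
by apply: wo_anti; rewrite yz' zy.
Qed.

HB.instance Definition _ := OrderTopological_isOmega1.Build omega1_display omega1
  omega1_minE omega1_segmentE omega1_uncountableE.

End Omega1Exists.

Section LongJames.
Context {R : realType} (k : scalar_kind) (p : R) (p1 : 1 < p).
Context {d : Order.disp_t} (W : omega1Type d).
Local Notation K := (scalar_field R k).
Implicit Types (x y : W -> K) (a : nat -> W) (n : nat).

(* Only the values a 0 < ... < a n matter. *)
Definition chain_upto n a := forall i, (i < n)%N -> (a i < a i.+1)%O.

Definition chain_sum x n a : R :=
  (\sum_(i < n) modulus (x (a i.+1) - x (a i)) `^ p) `^ p^-1.

Definition pvariation x : \bar R :=
  ereal_sup [set (chain_sum x na.1 na.2)%:E | na in
    [set na : nat * (nat -> W) | chain_upto na.1 na.2]].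

Definition long_James : {pred W -> K} :=
  mem [set x : W -> K | [/\ continuous x, x @ at_omega1 --> (0 : K)
                          & (pvariation x < +oo)%E]].

Lemma long_JamesP x : x \in long_James <->
  [/\ continuous x, x @ at_omega1 --> (0 : K) & (pvariation x < +oo)%E].
Proof. by rewrite inE. Qed.

Let p0 : 0 < p. Proof. exact: lt_trans p1. Qed.

Let pN0 : p != 0. Proof. by rewrite gt_eqF. Qed.

Lemma chain_sum_ge0 x n a : 0 <= chain_sum x n a.
Proof. exact: powR_ge0. Qed.

Lemma le_pvariation x n a : chain_upto n a ->
  ((chain_sum x n a)%:E <= pvariation x)%E.
Proof. by move=> na; apply: ereal_sup_ubound; exists (n, a). Qed.

Lemma pvariation_ge0 x : (0 <= pvariation x)%E.
Proof.
have [a _] := @omega1_inhabited d W.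
by apply: le_trans (@le_pvariation x 0 (fun=> a) _); rewrite // lee_fin chain_sum_ge0.
Qed.

Lemma pvariation_le x (M : \bar R) :
  (forall n a, chain_upto n a -> (chain_sum x n a)%:E <= M)%E ->
  (pvariation x <= M)%E.
Proof. by move=> xM; apply: ge_ereal_sup => _ [[n a] /= na <-]; exact: xM. Qed.

Lemma minkowski_sum n (u v : nat -> R) :
  (forall i, 0 <= u i) -> (forall i, 0 <= v i) ->
  (\sum_(i < n) (u i + v i) `^ p) `^ p^-1 <=
  (\sum_(i < n) u i `^ p) `^ p^-1 + (\sum_(i < n) v i `^ p) `^ p^-1.
Proof.
move=> u0 v0.
have sumE w : ((\sum_(i < n) w i `^ p) `^ p^-1) `^ p = \sum_(i < n) w i `^ p.
  by rewrite -powRrM mulVf// powRr1// sumr_ge0// => i _; exact: powR_ge0.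
have sum0 w : (forall i, 0 <= w i) -> (\sum_(i < n) w i `^ p) `^ p^-1 = 0 ->
    forall i : 'I_n, w i = 0.
  move=> w0 ws0 i; apply/(@powR_eq0_eq0 _ _ p)/eqP.
  have : \sum_(j < n) w j `^ p == 0 by rewrite -sumE ws0 powR0.
  rewrite psumr_eq0 => [/allP/(_ i)|j _]; last exact: powR_ge0.
  by rewrite mem_index_enum => /(_ isT).
set s := (\sum_(i < n) u i `^ p) `^ p^-1.
set t := (\sum_(i < n) v i `^ p) `^ p^-1.
have [s0|sN0] := eqVneq s 0.
  rewrite s0 add0r /t; under eq_bigr => i _ do rewrite (sum0 u u0 s0) add0r.
  exact: lexx.
have [t0|tN0] := eqVneq t 0.
  rewrite t0 addr0 /s; under eq_bigr => i _ do rewrite (sum0 v v0 t0) addr0.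
  exact: lexx.
have sp : 0 < s by rewrite lt0r sN0 powR_ge0.
have tp : 0 < t by rewrite lt0r tN0 powR_ge0.
have us : s `^ p = \sum_(i < n) u i `^ p by exact: sumE.
have vt : t `^ p = \sum_(i < n) v i `^ p by exact: sumE.
clearbody s t; have stp : 0 < s + t by exact: addr_gt0.
suff le1 : \sum_(i < n) (u i + v i) `^ p <= (s + t) `^ p.
  have -> : s + t = ((s + t) `^ p) `^ p^-1.
    by rewrite -powRrM mulfV// powRr1// ltW.
  rewrite ge0_ler_powR ?invr_ge0 ?nnegrE ?(ltW p0) ?powR_ge0//.
  by rewrite sumr_ge0// => i _; exact: powR_ge0.
have l0 : 0 <= s / (s + t) by rewrite divr_ge0 ?ltW.
have l1 : s / (s + t) <= 1 by rewrite ler_pdivrMr// mul1r lerDl ltW.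
have onemE : unstable.onem (s / (s + t)) = t / (s + t).
  by rewrite /unstable.onem -{1}(mulfV (lt0r_neq0 stp)) -mulrBl addrAC subrr add0r.
have cvx i : (u i + v i) `^ p <= (s + t) `^ p *
    (s / (s + t) * (u i `^ p / s `^ p) + t / (s + t) * (v i `^ p / t `^ p)).
  have us0 : 0 <= u i / s by rewrite divr_ge0 ?u0 ?ltW.
  have vt0 : 0 <= v i / t by rewrite divr_ge0 ?v0 ?ltW.
  have h : (s / (s + t) * (u i / s) + t / (s + t) * (v i / t)) `^ p <=
      s / (s + t) * (u i / s) `^ p + t / (s + t) * (v i / t) `^ p.
    rewrite -onemE; apply: (convex_powR (ltW p1) (Itv01 l0 l1)).
      by rewrite inE/= in_itv/= andbT.
    by rewrite inE/= in_itv/= andbT.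
  have -> : u i + v i = (s + t) * (s / (s + t) * (u i / s) + t / (s + t) * (v i / t)).
    by field; rewrite sN0 tN0 gt_eqF.
  have t0 : 0 <= t / (s + t) by rewrite divr_ge0 ?ltW.
  rewrite (powRM _ (ltW stp)); last by rewrite addr_ge0// mulr_ge0.
  rewrite ler_wpM2l ?powR_ge0// (le_trans h)//.
  have divE (a b : R) : 0 <= a -> 0 < b -> (a / b) `^ p = a `^ p / b `^ p.
    move=> a0 b0; rewrite powRM// ?invr_ge0 ?ltW//.
    by rewrite -powR_inv1 ?ltW// powRAC powR_inv1// powR_ge0.
  by rewrite !divE.
apply: (le_trans (ler_sum _ (fun (i : 'I_n) _ => cvx i))).
rewrite -mulr_sumr big_split/= -!mulr_sumr -!mulr_suml.
rewrite -us -vt !divff ?gt_eqF ?powR_gt0// !mulr1.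
by rewrite -mulrDl divff ?gt_eqF// mulr1.
Qed.

Lemma pvariationD x y :
  (pvariation (x \+ y)%R <= pvariation x + pvariation y)%E.
Proof.
apply: pvariation_le => n a na.
apply: (@le_trans _ _ ((chain_sum x n a)%:E + (chain_sum y n a)%:E)%E); last first.
  by rewrite leeD ?le_pvariation.
pose mx i := modulus (x (a i.+1) - x (a i)).
pose my i := modulus (y (a i.+1) - y (a i)).
have mx0 i : 0 <= mx i by exact: modulus_ge0.
have my0 i : 0 <= my i by exact: modulus_ge0.
rewrite -EFinD lee_fin; apply: le_trans (minkowski_sum n mx0 my0).
have sum_ge0 (u : nat -> R) : 0 <= \sum_(i < n) u i `^ p.
  by apply: sumr_ge0 => i _; exact: powR_ge0.
apply: ge0_ler_powR; rewrite ?nnegrE ?invr_ge0 ?(ltW p0)//.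
- exact: (sum_ge0 (fun i => modulus ((x \+ y) (a i.+1) - (x \+ y) (a i)))).
- exact: (sum_ge0 (fun i => mx i + my i)).
apply: ler_sum => i _.
apply: ge0_ler_powR; rewrite ?nnegrE ?(ltW p0) ?addr_ge0 ?modulus_ge0//.
by apply: le_trans (modulusD _ _); rewrite opprD addrACA.
Qed.

Lemma chain_sumZ (c : K) x n a :
  chain_sum (fun b => c * x b) n a = modulus c * chain_sum x n a.
Proof.
rewrite /chain_sum.
under eq_bigr => i _ do rewrite -mulrBr modulusM powRM ?modulus_ge0//.
rewrite -mulr_sumr powRM ?powR_ge0//; last first.
  by apply: sumr_ge0 => i _; exact: powR_ge0.
by rewrite -powRrM mulfV// powRr1// modulus_ge0.
Qed.

Lemma pvariationZ (c : K) x :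
  (pvariation (fun b => c * x b)%R <= (modulus c)%:E * pvariation x)%E.
Proof.
apply: pvariation_le => n a na; rewrite chain_sumZ EFinM.
by rewrite lee_wpmul2l ?lee_fin ?modulus_ge0// le_pvariation.
Qed.

Lemma long_James_submod_closed : submod_closed long_James.
Proof.
split.
  apply/long_JamesP; split; first by move=> b; exact: cvg_cst.
    exact: cvg_cst.
  apply: (@le_lt_trans _ _ 0%E); last exact: ltry.
  apply: pvariation_le => n a _; rewrite lee_fin /chain_sum big1 ?powR0 ?invr_neq0//.
  by move=> i _; rewrite subrr modulus0 powR0.
move=> c x y /long_JamesP[cx x0 vx] /long_JamesP[cy y0 vy].
apply/long_JamesP; split.
- by move=> b; apply: cvgD; [apply: cvgM; [exact: cvg_cst|exact: cx]|exact: cy].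
- have -> : (0 : K) = c * 0 + 0 by rewrite mulr0 addr0.
  by apply: cvgD => //; apply: cvgM => //; exact: cvg_cst.
- apply: (le_lt_trans (pvariationD (fun b => c * x b) y)).
  apply: lte_add_pinfty; last exact: vy.
  apply: (le_lt_trans (pvariationZ c x)).
  apply: lte_mul_pinfty; last exact: vx.
    by rewrite lee_fin modulus_ge0.
  by [].
Qed.

End LongJames.
Arguments pvariation {R k} p {d W} x.
Arguments long_James {R} k p {d} W.
Arguments long_James_submod_closed {R} k {p} p1 {d} W.

(* The bound on p is a parameter because the norm axioms fail for p < 1. *)
Record long_James_space (R : realType) (k : scalar_kind) (p : R) (p1 : 1 < p)
    (d : Order.disp_t) (W : omega1Type d) := LongJamesSpace {
  long_James_fun :> W -> scalar_field R k ;
  _ : long_James_fun \in long_James k p W }.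

Section LongJamesNorm.
Context {R : realType} {k : scalar_kind} {p : R} {p1 : 1 < p}.
Context {d : Order.disp_t} {W : omega1Type d}.
Local Notation K := (scalar_field R k).
Local Notation J := (long_James_space k p1 W).
Implicit Types x y : J.

Let p0 : 0 < p. Proof. exact: lt_trans p1. Qed.

Let pN0 : p != 0. Proof. by rewrite gt_eqF. Qed.

HB.instance Definition _ := GRing.isSubmodClosed.Build _ _ (long_James k p W)
  (long_James_submod_closed k p1 W).

HB.instance Definition _ := [isSub for @long_James_fun R k p p1 d W].
HB.instance Definition _ := [Choice of J by <:].
HB.instance Definition _ := [SubChoice_isSubLmodule of J by <:].

Definition long_James_norm x : K :=
  of_real k (fine (pvariation p x)).

Lemma pvariation_fin x : pvariation p x \is a fin_num.
Proof.
case: x => f fP; have /long_JamesP[_ _ vf] := fP.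
by rewrite ge0_fin_numE ?pvariation_ge0.
Qed.

Let fine_leD (u v w : \bar R) : u \is a fin_num -> v \is a fin_num ->
  w \is a fin_num -> (w <= u + v)%E -> fine w <= fine u + fine v.
Proof. by move: u v w => [u||] [v||] [w||]. Qed.

Let fine_leM (c : R) (u v : \bar R) : u \is a fin_num -> v \is a fin_num ->
  (v <= c%:E * u)%E -> fine v <= c * fine u.
Proof. by move: u v => [u||] [v||]. Qed.

Lemma long_James_normD x y :
  long_James_norm (x + y) <= long_James_norm x + long_James_norm y.
Proof.
rewrite /long_James_norm -of_realD of_real_le.
exact (fine_leD (pvariation_fin x) (pvariation_fin y) (pvariation_fin (x + y))
  (pvariationD p1 x y)).
Qed.

Lemma long_James_normZ (c : K) x :
  long_James_norm (c *: x) = `|c| * long_James_norm x.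
Proof.
have le_Z a y : long_James_norm (a *: y) <= `|a| * long_James_norm y.
  rewrite /long_James_norm -of_real_modulus -of_realM of_real_le.
  exact (fine_leM (pvariation_fin y) (pvariation_fin (a *: y))
    (pvariationZ p1 a y)).
apply/eqP; rewrite eq_le le_Z/=.
have [->|c0] := eqVneq c 0.
  rewrite normr0 mul0r /long_James_norm -of_real0 of_real_le.
  by apply: fine_ge0; exact: pvariation_ge0.
have xE : c^-1 *: (c *: x) = x by rewrite scalerA (mulVf c0) scale1r.
rewrite -ler_pdivlMl ?normr_gt0// -normfV.
by have := le_Z c^-1 (c *: x); rewrite xE.
Qed.

Lemma long_James_norm0_eq0 x : long_James_norm x = 0 -> x = 0.
Proof.
rewrite /long_James_norm -of_real0 => /of_real_inj x0.
have v0 : pvariation p x = 0%E by rewrite -(fineK (pvariation_fin x)) x0.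
have lt_cst b c : (b < c)%O -> x b = x c.
  move=> bc; pose a (i : nat) := if i is 0%N then b else c.
  have a1 : chain_upto 1 a by case.
  have := le_pvariation p x a1; rewrite v0 lee_fin /chain_sum big_ord1/=.
  rewrite -powRrM mulfV// powRr1 ?modulus_ge0// => le0.
  by apply/esym/eqP; rewrite -subr_eq0; apply/eqP/modulus_eq0/le_anti;
     rewrite le0 modulus_ge0.
have [_ xlim _] : [/\ continuous x, x @ at_omega1 --> (0 : K)
    & (pvariation p x < +oo)%E] by apply/long_JamesP; case: {+}x.
apply/val_inj/funext => b /=.
suff : x @ at_omega1 --> x b by move=> xb; exact: (cvg_unique _ xb xlim).
apply: cvg_near_cst; exists b => // c /= bc.
by rewrite (lt_cst _ _ bc).
Qed.

HB.instance Definition _ := Lmodule_isNormed.Build K J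
  long_James_normD long_James_normZ long_James_norm0_eq0.

End LongJamesNorm.

(* Main.v *)
(* Write J for J_p(omega_1) and e_b for the indicator function of [0,b]. An
   operator S has a matrix (S e_b)(a). Its columns are eventually zero, and its
   rows are eventually constant because, p being > 1, the sum of n normalised
   functions with disjoint supports has norm O(n^(1/p)). The limits of the rows
   form a function of bounded p-variation of a, which is thus eventually equal
   to some z. Hence S - z I belongs to the set M of the operators whose row
   limits vanish eventually, and it suffices to bound the homomorphism phi on
   the unit ball of M. The e_b span a dense subspace, so that for S_n in M a
   closing-off argument gives a closed unbounded set D on which all the functions
   S_n x vanish. Placing infinitely many disjoint copies of each gap of D one
   after the other gives operators z_i (of norm at most 1) and w_j with
   w_j z_i S_n = S_n if i = j, and 0 otherwise. If phi were unbounded, one could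
   choose the S_n in the unit ball with phi(S_n) unbounded, and then (n_j) growing
   so fast with respect to the norms of phi(w_j) that the operator
   T = sum_i 2^-i z_i S_(n_i) would contradict
   2^-j phi(S_(n_j)) = phi(w_j) phi(T). *)

Require Import Defs.
From mathcomp Require Import all_boot all_order all_algebra.
From mathcomp Require Import complex.
From mathcomp Require Import all_classical all_reals all_analysis.
From mathcomp Require Import ring lra.

Set Implicit Arguments.
Unset Strict Implicit.
Unset Printing Implicit Defensive.

Import Order.TTheory GRing.Theory Num.Theory.
Import numFieldNormedType.Exports.

Local Open Scope classical_set_scope.
Local Open Scope ring_scope.

(** * The order and the topology of [0, omega_1) *)

Section Omega1Order.
Context {d : Order.disp_t} {W : omega1Type d}.
Implicit Types a b c : W.

Lemma omega1_initial_countable a : countable [set b | (b <= a)%O].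
Proof.
have -> : [set b | (b <= a)%O] = [set b | (b < a)%O] `|` [set a].
  apply/seteqP; split=> b /=; first by rewrite le_eqVlt => /orP[/eqP|]; [right|left].
  by move=> [/ltW|->].
rewrite -bigcup2E; apply: bigcup_countable => // -[|[|i]] _ /=.
- exact: omega1_segment.
- exact: countable1.
- exact: countable0.
Qed.

(** Otherwise W would be a countable union of countable initial segments. *)
Lemma omega1_countable_bounded (A : set W) :
  countable A -> exists b, forall a, A a -> (a < b)%O.
Proof.
move=> Ac.
suff [b bP] : exists b, ~ (\bigcup_(a in A) [set c | (c <= a)%O]) b.
  by exists b => a Aa; rewrite ltNge; apply/negP => ba; apply: bP; exists a.
apply: contrapT => /forallNP h; apply: (@omega1_uncountable d W).
have -> : [set: W] = \bigcup_(a in A) [set c | (c <= a)%O].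
  by apply/seteqP; split=> // b _; exact: contrapT.
apply: bigcup_countable => // a _.
exact: omega1_initial_countable.
Qed.

Lemma omega1_seq_bounded (u : nat -> W) : exists b, forall n, (u n < b)%O.
Proof.
have [|b ub] := @omega1_countable_bounded (range u).
  by apply: (sub_countable (card_image_le _ _)); exact: countableP.
by exists b => n; apply: ub; exists n.
Qed.

Lemma omega1_ind (P : W -> Prop) :
  (forall a, (forall b, (b < a)%O -> P b) -> P a) -> forall a, P a.
Proof.
move=> ih a; apply: contrapT => Pa.
have [|c Pc cmin] := @omega1_min d W [set c | ~ P c]; first by exists a.
apply: Pc; apply: ih => b bc; apply: contrapT => /cmin.
by rewrite leNgt bc.
Qed.

Definition is_limit a :=
  (exists b, (b < a)%O) /\ forall b, (b < a)%O -> exists2 c, (b < c)%O & (c < a)%O.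

Variant limit_spec a : Prop :=
| LimitZero of (forall b, (a <= b)%O)
| LimitSucc b of (b < a)%O & (forall c, (b < c)%O -> (a <= c)%O)
| LimitLimit of is_limit a.

Lemma limitP a : limit_spec a.
Proof.
have [[b ba]|/forallNP a0] := pselect (exists b, (b < a)%O); last first.
  by apply: LimitZero => b; rewrite leNgt; exact/negP.
have [la|] := pselect (forall b, (b < a)%O -> exists2 c, (b < c)%O & (c < a)%O).
  by apply: LimitLimit; split=> //; exists b.
move=> /existsNP[c /not_implyP[ca cN]]; apply: (@LimitSucc _ c) => // e ce.
by rewrite leNgt; apply/negP => ea; apply: cN; exists e.
Qed.

Lemma near_limit a (P : set W) : (\forall c \near a, P c) -> is_limit a ->
  exists2 b, (b < a)%O & forall c, (b < c)%O -> (c <= a)%O -> P c.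
Proof.
rewrite /prop_near1 itv_nbhsE => -[[l r] /= [lr alr] lrP] [[e ea] _].
have rc c : (c <= a)%O -> ((BRight c) <= r)%O.
  move=> ca; move: alr; rewrite itv_boundlr => /andP[_]; apply: le_trans.
  exact: ca.
case: l lr alr lrP => [[] b|[]] lr alr lrP.
- by case: r lr {alr lrP rc} => [[] ?|[]] [].
- have ba : (b < a)%O by move: alr; rewrite itv_boundlr => /andP[].
  exists b => // c bc ca; apply: lrP => /=; rewrite itv_boundlr rc// andbT.
  exact: bc.
- by exists e => // c _ ca; apply: lrP => /=; rewrite itv_boundlr rc// andbT.
- by move: alr; rewrite itv_boundlr => /andP[].
Qed.

(** Every a has an immediate successor s, and []-oo, s[] is an open set with greatest element a.
    Hence only the left side of a matters, and only when a is a limit. *)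
Lemma limit_near a (P : set W) : P a -> (is_limit a ->
    exists2 b, (b < a)%O & forall c, (b < c)%O -> (c <= a)%O -> P c) ->
  \forall c \near a, P c.
Proof.
move=> Pa Plim; have [s0 as0] := omega1_unbounded a.
have [|s as_ smin] := @omega1_min d W [set s | (a < s)%O]; first by exists s0.
have lt_s c : (c < s)%O -> (c <= a)%O.
  by move=> cs; rewrite leNgt; apply/negP => /smin; rewrite leNgt cs.
have aray : nbhs a [set` `]-oo, s[%O].
  by rewrite nbhsE /=; exists [set` `]-oo, s[%O] => //; by split; [exact: lray_open|exact: as_].
have near_gt b : (b < a)%O -> nbhs a [set` `]b, s[%O].
  move=> ba; rewrite nbhsE /=; exists [set` `]b, s[%O] => //; split.
    exact: itv_open.
  by apply/andP; split; [exact: ba|exact: as_].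
have [a0|b ba bmin|la] := limitP a.
- apply: filterS aray => c /lt_s ca.
  by have -> : c = a by apply/le_anti; rewrite ca a0.
- apply: filterS (near_gt _ ba) => c /andP[bc /lt_s ca].
  by have -> : c = a by apply/le_anti; rewrite ca bmin.
- have [b ba bP] := Plim la.
  apply: filterS (near_gt _ ba) => c /andP[bc /lt_s ca].
  exact: bP.
Qed.

Lemma continuous_limit (T : topologicalType) (f : W -> T) :
  (forall a, is_limit a -> forall U, nbhs (f a) U ->
    exists2 b, (b < a)%O & forall c, (b < c)%O -> (c <= a)%O -> U (f c)) ->
  continuous f.
Proof.
move=> flim a U Ua; apply: (@limit_near a (f @^-1` U)) => [|la].
  exact: (nbhs_singleton Ua).
exact: flim.
Qed.

Lemma omega1_sup (u : nat -> W) : (forall n, (u n < u n.+1)%O) ->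
  exists a, [/\ is_limit a, forall n, (u n < a)%O
    & forall b, (b < a)%O -> exists n, (b < u n)%O].
Proof.
move=> ui; have [s0 us0] := omega1_seq_bounded u.
have [|a ua amin] := @omega1_min d W [set s | forall n, (u n < s)%O].
  by exists s0.
have cof b : (b < a)%O -> exists n, (b < u n)%O.
  move=> ba; apply: contrapT => /forallNP bu.
  have : (a <= b)%O.
    apply: amin => n; rewrite (lt_le_trans (ui n))// leNgt; exact/negP.
  by rewrite leNgt ba.
exists a; split => //; split=> [|b /cof[n bn]]; last by exists (u n).
by exists (u 0%N).
Qed.

Lemma omega1_iterate (G : W -> W -> Prop) : (forall a, exists b, G a b) ->
  forall a0, exists u : nat -> W, u 0%N = a0 /\ forall n, G (u n) (u n.+1).
Proof.
move=> /choice[g gG] a0; exists (fun n => iter n g a0); split=> //.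
Qed.

End Omega1Order.

(** * The p-variation along finite chains *)

Section ChainSums.
Context {R : realType} {k : scalar_kind} {p : R} (p1 : 1 < p).
Context {d : Order.disp_t} {W : omega1Type d}.
Local Notation K := (scalar_field R k).
Implicit Types (x y : W -> K) (a b : W) (s t : seq W) (c : R).

Let p0 : 0 < p. Proof. exact: lt_trans p1. Qed.

Let pN0 : p != 0. Proof. by rewrite gt_eqF. Qed.

(** The p-th power of [chain_sum], for a chain given by its head and a list, so that chains can be
    concatenated and mapped. *)
Fixpoint vsum x a s : R :=
  if s is b :: s' then modulus (x b - x a) `^ p + vsum x b s' else 0.

Lemma vsum_ge0 x a s : 0 <= vsum x a s.
Proof. by elim: s a => //= b s ih a; rewrite addr_ge0 ?powR_ge0. Qed.

Lemma vsum_cat x a s t : vsum x a (s ++ t) = vsum x a s + vsum x (last a s) t.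
Proof. by elim: s a => [a|b s ih a] /=; rewrite ?add0r// ih addrA. Qed.

Lemma vsum_comp x (f : W -> W) a s :
  vsum (x \o f) a s = vsum x (f a) (map f s).
Proof. by elim: s a => //= b s ih a; rewrite ih. Qed.

Lemma eq_vsum x y a s : (forall b b', x b - x b' = y b - y b') ->
  vsum x a s = vsum y a s.
Proof. by move=> xy; elim: s a => //= b s ih a; rewrite ih xy. Qed.

Lemma vsum_iota x (u : nat -> W) n m :
  vsum x (u m) [seq u i | i <- iota m.+1 n] =
  \sum_(i < n) modulus (x (u (m + i).+1) - x (u (m + i)%N)) `^ p.
Proof.
elim: n m => [m|n ih m] /=; first by rewrite big_ord0.
rewrite big_ord_recl ih addn0; congr (_ + _).
by apply: eq_bigr => i _; rewrite lift0 addnS addSn.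
Qed.

Lemma path_iota (u : nat -> W) n m :
  (forall i, (m <= i < m + n)%N -> (u i < u i.+1)%O) ->
  path <%O (u m) [seq u i | i <- iota m.+1 n].
Proof.
elim: n m => //= n ih m h; rewrite h ?leqnn ?addnS ?ltnS ?leq_addr//=.
apply: ih => i /andP[mi ni]; apply: h; rewrite (ltnW mi)/=.
by rewrite addnS -addSn.
Qed.

Lemma chain_sum_vsum x n (u : nat -> W) :
  chain_sum p x n u = vsum x (u 0%N) [seq u i | i <- iota 1 n] `^ p^-1.
Proof. by rewrite vsum_iota. Qed.

Lemma vsum_chain a s : path <%O a s ->
  exists u : nat -> W, [/\ chain_upto (size s) u &
    u 0%N = a /\ [seq u i | i <- iota 1 (size s)] = s].
Proof.
move=> /(pathP a) as_; exists (nth a (a :: s)); split=> //; split=> //.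
rewrite -add1n iotaDl -map_comp -[RHS](mkseq_nth a).
by [].
Qed.

Lemma vsum_weak x a s : path <=%O a s -> exists t,
  [/\ path <%O a t, last a t = last a s & vsum x a s = vsum x a t].
Proof.
elim: s a => [a _|b s ih a /= /andP[]]; first by exists [::].
rewrite le_eqVlt => /orP[/eqP <- /ih[t [at_ tl ->]]|ab /ih[t [bt tl ->]]].
  by exists t; split=> //; rewrite subrr modulus0 powR0// add0r.
by exists (b :: t); rewrite /= ab.
Qed.

Lemma vsum_le_pvariation x c a s : (pvariation p x <= c%:E)%E ->
  path <=%O a s -> vsum x a s <= c `^ p.
Proof.
move=> xc /(vsum_weak x)[t [/vsum_chain[u [ut [<- ts]]] _ ->]].
have := le_trans (le_pvariation p x ut) xc.
rewrite chain_sum_vsum ts lee_fin => h.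
have -> : vsum x (u 0%N) t = (vsum x (u 0%N) t `^ p^-1) `^ p.
  by rewrite -powRrM mulVf// powRr1// vsum_ge0.
by apply: ge0_ler_powR => //; rewrite ?(ltW p0) ?nnegrE ?powR_ge0// (le_trans _ h)// powR_ge0.
Qed.

Lemma pvariation_le_vsum x c : 0 <= c ->
  (forall a s, path <%O a s -> vsum x a s <= c `^ p) ->
  (pvariation p x <= c%:E)%E.
Proof.
move=> c0 xc; apply: pvariation_le => n u nu; rewrite lee_fin chain_sum_vsum.
have -> : c = (c `^ p) `^ p^-1 by rewrite -powRrM mulfV// powRr1.
apply: ge0_ler_powR; rewrite ?invr_ge0 ?(ltW p0) ?nnegrE ?vsum_ge0 ?powR_ge0//.
by apply: xc; apply: path_iota => i /andP[_ /nu].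
Qed.

Lemma pvariation_pair x c a b : (pvariation p x <= c%:E)%E ->
  modulus (x b - x a) <= c.
Proof.
move=> xc; wlog ab : a b / (a <= b)%O.
  move=> h; have [/h//|/ltW/h] := leP a b.
  rewrite -modulus_normr distrC modulus_normr; exact.
have c0 : 0 <= c by rewrite -lee_fin (le_trans (pvariation_ge0 p x)).
have /(vsum_le_pvariation xc) : path <=%O a [:: b] by rewrite /= ab.
rewrite /= addr0 => h; rewrite leNgt; apply/negP => cx.
by have := gt0_ltr_powR p0 c0 (modulus_ge0 _) cx; rewrite ltNge h.
Qed.

(* Only the jumps between distinct values of the counter f contribute. *)
Lemma pvariation_step x (f : W -> nat) (v : nat -> K) n c :
  {homo f : a b / (a <= b)%O >-> (a <= b)%N} -> (forall a, (f a <= n)%N) ->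
  (forall i, modulus (v i) <= c) -> x =1 v \o f ->
  (pvariation p x <= ((n%:R `^ p^-1) * (c + c))%:E)%E.
Proof.
move=> fhomo fn vc xE.
have c0 : 0 <= c by apply: le_trans (vc 0%N); exact: modulus_ge0.
apply: pvariation_le_vsum => [|a s as_].
  by rewrite mulr_ge0 ?powR_ge0// addr_ge0.
rewrite powRM ?powR_ge0 ?addr_ge0// -powRrM mulVf// powRr1//.
have fle : (f a <= f (last a s))%N.
  by elim: s a as_ => //= b s ih a /andP[/ltW/fhomo/leq_trans ab /ih /ab].
(* The induction uses a bound by the rise of f along the chain, which is additive, unlike n. *)
apply: (@le_trans _ _ ((f (last a s) - f a)%:R * (c + c) `^ p)); last first.
  by rewrite ler_wpM2r ?powR_ge0// ler_nat (leq_trans (leq_subr _ _)).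
elim: s a as_ {fle} => [a _|b s ih a /=/andP[ab bs]] /=.
  by rewrite subnn mul0r.
have fab : (f a <= f b)%N by exact/fhomo/ltW.
have fbl : (f b <= f (last b s))%N.
  by elim: s b {ih ab fab} bs => //= e s ih b /andP[/ltW/fhomo/leq_trans ab /ih /ab].
have -> : (f (last b s) - f a = (f b - f a) + (f (last b s) - f b))%N.
  by rewrite addnC addnBA// subnK.
rewrite natrD mulrDl lerD ?ih// !xE/=.
have [->|fNab] := eqVneq (f a) (f b).
  by rewrite subrr modulus0 powR0// subnn mul0r.
apply: (@le_trans _ _ ((c + c) `^ p)).
  apply: ge0_ler_powR; rewrite ?(ltW p0) ?nnegrE ?modulus_ge0 ?addr_ge0//.
  apply: le_trans (modulusD _ _) _; rewrite lerD//.
  by rewrite -modulus_normr normrN modulus_normr.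
by rewrite ler_peMl ?powR_ge0// ler1n subn_gt0 ltn_neqAle fNab.
Qed.

End ChainSums.

(** * Modulus estimates and eventually constant functions *)

Section ModulusAndTails.
Context {R : realType} {k : scalar_kind}.
Context {d : Order.disp_t} {W : omega1Type d}.
Local Notation K := (scalar_field R k).

Lemma modulusB_sym (z z' : K) : modulus (z - z') = modulus (z' - z).
Proof. by rewrite -modulus_normr distrC modulus_normr. Qed.

Lemma modulus1 : modulus (1 : K) = 1.
Proof. by rewrite -of_real1 modulus_of_real. Qed.

Lemma modulusV (z : K) : modulus z^-1 = (modulus z)^-1.
Proof.
have [->|z0] := eqVneq z 0; first by rewrite invr0 modulus0 invr0.
have mz0 : modulus z != 0 by apply: contra_neq z0; exact: modulus_eq0.
by apply: (mulIf mz0); rewrite -modulusM !mulVf// modulus1.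
Qed.

Lemma of_real_nat n : of_real k (n%:R : R) = n%:R.
Proof. by elim: n => [|n ih]; rewrite ?of_real0// -!natr1 of_realD ih of_real1. Qed.

Lemma modulus_nat n : modulus (n%:R : K) = n%:R.
Proof. by rewrite -of_real_nat modulus_of_real. Qed.

Lemma modulus_small_eq0 (z : K) :
  (forall e : R, 0 < e -> modulus z <= e) -> z = 0.
Proof.
move=> ze; apply: modulus_eq0; apply/eqP; rewrite eq_le modulus_ge0 andbT.
by apply/ler_addgt0Pl => e e0; rewrite addr0 ze.
Qed.

Lemma natSinv_lt (e : R) : 0 < e -> exists n : nat, n.+1%:R^-1 < e.
Proof.
move=> e0; have [n _ h] := near_infty_natSinv_lt (PosNum e0).
by exists n; exact: (h n (leqnn n)).
Qed.

(** If increments of size 1/(n+1) occurred beyond every point, iteration would give a sequence that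
    the hypothesis excludes. So all increments from some [u n] on are below 1/(n+1), and a common
    bound of the [u n] serves for every n. *)
Lemma eventually_constant (F : W -> K) :
  (forall e : R, 0 < e -> forall u : nat -> W, (forall i, (u i < u i.+1)%O) ->
    (forall i, e <= modulus (F (u i.+1) - F (u i))) -> False) ->
  exists a, forall b, (a < b)%O -> F b = F a.
Proof.
move=> FN.
have small (n : nat) : exists a, forall b, (a < b)%O ->
    modulus (F b - F a) < n.+1%:R^-1.
  apply: contrapT => /forallNP jump.
  have [|u [_ uP]] := @omega1_iterate d W (fun a b => (a < b)%O /\
      n.+1%:R^-1 <= modulus (F b - F a)) _ (sval (cid omega1_inhabited)).
    move=> a; have /existsNP[b /not_implyP[ab /negP]] := jump a.
    by rewrite -leNgt; exists b.
  by apply: (FN n.+1%:R^-1 _ u) => [|i|i]; rewrite ?invr_gt0//; case: (uP i).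
have [u uP] := choice small; have [a ua] := omega1_seq_bounded u.
exists a => b ab; apply/eqP; rewrite -subr_eq0; apply/eqP/modulus_small_eq0.
move=> e e0; have /natSinv_lt[n ne] : 0 < e / 2 by rewrite divr_gt0.
have -> : F b - F a = (F b - F (u n)) + (F (u n) - F a) by rewrite subrKA.
apply: le_trans (modulusD _ _) _; rewrite (splitr e) lerD//.
  by rewrite ltW// (lt_trans _ ne)// uP// (lt_trans _ ab).
by rewrite modulusB_sym ltW// (lt_trans _ ne)// uP.
Qed.

End ModulusAndTails.

(** * Elements of J, their norm, and the indicator functions of initial segments *)

Section LongJamesElements.
Context {R : realType} {k : scalar_kind} {p : R} {p1 : 1 < p}.
Context {d : Order.disp_t} {W : omega1Type d}.
Local Notation K := (scalar_field R k).
Local Notation J := (long_James_space k p1 W).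
Implicit Types (x y : J) (a b c : W).

Definition rnorm x : R := fine (pvariation p x).

Lemma normE x : `|x| = of_real k (rnorm x).
Proof. by []. Qed.

Lemma pvariationE x : pvariation p x = (rnorm x)%:E.
Proof. by rewrite fineK// pvariation_fin. Qed.

Lemma rnorm_ge0 x : 0 <= rnorm x.
Proof. by rewrite fine_ge0// pvariation_ge0. Qed.

Lemma rnorm_le x (c : R) : (pvariation p x <= c%:E)%E -> rnorm x <= c.
Proof. by rewrite pvariationE lee_fin. Qed.

Lemma long_James_addE x y a : (x + y) a = x a + y a. Proof. by []. Qed.

Lemma long_James_oppE x a : (- x) a = - x a. Proof. by []. Qed.

Lemma long_James_scaleE (z : K) x a : (z *: x) a = z * x a. Proof. by []. Qed.

Lemma long_James_zeroE a : (0 : J) a = 0. Proof. by []. Qed.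

Lemma long_James_sumE n (x : nat -> J) a :
  (\sum_(i < n) x i) a = \sum_(i < n) x i a.
Proof.
by elim: n => [|n ih]; rewrite ?big_ord0// 2!big_ord_recr long_James_addE ih.
Qed.

Lemma long_JamesE x y : (forall a, x a = y a) -> x = y.
Proof. by move=> xy; exact/val_inj/funext. Qed.

Lemma long_James_cont x : continuous x.
Proof. by case: x => f fP; have /long_JamesP[] := fP. Qed.

Lemma modulus_gt0 (e : K) : 0 < e -> 0 < modulus e.
Proof.
move=> e0; rewrite lt0r modulus_ge0 andbT; apply/eqP => /modulus_eq0 e00.
by rewrite e00 ltxx in e0.
Qed.

Lemma modulus_lt (z e : K) : 0 < e -> modulus z < modulus e -> `|z| < e.
Proof.
move=> e0 ze; rewrite -(gtr0_norm e0) -!of_real_modulus lt_neqAle of_real_le ltW//.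
by rewrite andbT; apply/eqP => /of_real_inj ze'; rewrite ze' ltxx in ze.
Qed.

Lemma lt_modulus (z : K) (e : R) : 0 <= e -> `|z| < of_real k e -> modulus z < e.
Proof.
move=> e0; rewrite -of_real_modulus lt_neqAle of_real_le => /andP[ne le].
by rewrite lt_neqAle le andbT; apply: contraNneq ne => ->.
Qed.

Lemma of_real_gt0 (e : R) : 0 < e -> 0 < of_real k e.
Proof.
move=> e0; rewrite lt_neqAle -{2}(of_real0 (k := k)) of_real_le (ltW e0) andbT.
by apply/eqP; rewrite -(of_real0 (k := k)) => /of_real_inj e00; rewrite -e00 ltxx in e0.
Qed.

(** The modulus of x is below 1/(n+1) beyond some [u n], and the countably many [u n] have a common
    bound. *)
Lemma long_James_eventually0 x : exists a, forall b, (a < b)%O -> x b = 0.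
Proof.
have xlim : x @ at_omega1 --> (0 : K).
  by case: x => f fP; have /long_JamesP[] := fP.
have small (n : nat) : exists a, forall b, (a < b)%O -> modulus (x b) < n.+1%:R^-1.
  have e0 : 0 < of_real k (n.+1%:R^-1 : R) by rewrite of_real_gt0// invr_gt0.
  have /cvgrPdist_lt/(_ _ e0)[a _ aP] := xlim; exists a => b /aP /=.
  by rewrite sub0r normrN; apply: lt_modulus; rewrite invr_ge0.
have [u uP] := choice small; have [a ua] := omega1_seq_bounded u.
exists a => b ab; apply/modulus_small_eq0 => e e0.
have [n h] := natSinv_lt e0.
by rewrite ltW// (lt_trans _ h)// uP// (lt_trans (ua n)).
Qed.

Lemma long_James_mem (f : W -> K) (c : R) : continuous f ->
  (exists a, forall b, (a < b)%O -> f b = 0) -> (pvariation p f <= c%:E)%E ->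
  f \in long_James k p W.
Proof.
move=> fc [a fa] fv; apply/long_JamesP; split=> //.
  by apply: cvg_near_cst; exists a => // b /= /fa.
exact: le_lt_trans fv (ltry _).
Qed.

Lemma long_James_diff x a b : modulus (x b - x a) <= rnorm x.
Proof. by apply: (pvariation_pair p1); rewrite pvariationE. Qed.

(** The value at a is a difference with a value that vanishes. *)
Lemma long_James_eval x a : modulus (x a) <= rnorm x.
Proof.
have [b bP] := long_James_eventually0 x; have [c bc] := omega1_unbounded b.
by have := long_James_diff x c a; rewrite (bP c bc) subr0.
Qed.

Lemma long_James_vsum x a (s : seq W) : path <=%O a s ->
  vsum (p := p) x a s <= rnorm x `^ p.
Proof. by apply: (vsum_le_pvariation p1); rewrite pvariationE. Qed.

Lemma long_James_left x a (e : R) : 0 < e -> is_limit a ->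
  exists2 b, (b < a)%O &
    forall c, (b < c)%O -> (c <= a)%O -> modulus (x c - x a) <= e.
Proof.
move=> e0; apply: near_limit.
have /cvgrPdist_lt/(_ _ (of_real_gt0 e0)) := @long_James_cont x a.
apply: filterS => c /(lt_modulus (ltW e0)) h.
by rewrite modulusB_sym ltW.
Qed.

Lemma continuous_left (f : W -> K) :
  (forall a, is_limit a -> forall e : R, 0 < e -> exists2 b, (b < a)%O &
    forall c, (b < c)%O -> (c <= a)%O -> modulus (f c - f a) <= e) ->
  continuous f.
Proof.
move=> fl; apply: continuous_limit => a la U /nbhs_ballP[/= e e0 eU].
(* Half the radius turns the weak inequality of the hypothesis into the strict one of the ball. *)
have e2 : 0 < modulus e / 2 by rewrite divr_gt0 ?modulus_gt0.
have [b ba bP] := fl a la _ e2; exists b => // c bc ca; apply: eU.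
rewrite -ball_normE /=; apply: modulus_lt => //.
rewrite modulusB_sym (le_lt_trans (bP c bc ca))// ltr_pdivrMr// ltr_pMr ?modulus_gt0//.
by rewrite ltr1n.
Qed.

Lemma pvariation_cut a :
  (pvariation p (fun b => (b <= a)%O%:R : K) <= 2%:E)%E.
Proof.
have -> : 2 = 1%:R `^ p^-1 * (1 + 1) :> R by rewrite powR1 mul1r.
apply: (@pvariation_step _ _ _ p1 _ _ _ (fun b => (a < b)%O : nat)
  (fun n => if n is 0%N then 1 else 0)).
+ move=> b c bc; have [ab|//] := ltP a b.
  by rewrite (lt_le_trans ab bc).
+ by move=> b; case: (_ < _)%O.
+ case=> [|n]; last by rewrite modulus0.
  by rewrite -of_real1 modulus_of_real.
+ by move=> b /=; rewrite leNgt; case: (a < b)%O.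
Qed.

Lemma cut_mem a : (fun b => (b <= a)%O%:R : K) \in long_James k p W.
Proof.
apply: (@long_James_mem _ 2).
- apply: continuous_left => b [[b0 bb0] _] e e0; have [ba|ab] := leP b a.
    by exists b0 => // c _ cb; rewrite (le_trans cb ba) subrr modulus0 ltW.
  exists a => // c ac cb; by rewrite /= (lt_geF ac) subrr modulus0 ltW.
- by exists a => b ab; rewrite (lt_geF ab).
- exact: pvariation_cut.
Qed.

(** In the notation above, this is e_a. *)
Definition cut a : J := LongJamesSpace p1 (cut_mem a).

Lemma cutE a b : cut a b = (b <= a)%O%:R. Proof. by []. Qed.

Lemma rnorm_cut a : rnorm (cut a) <= 2.
Proof. exact/rnorm_le/pvariation_cut. Qed.

(** The sum is constant on each block []u i, u i.+1]] and zero outside the blocks, so it has at most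
    n+1 jumps, each of modulus at most 2c. *)
Lemma rnorm_blocks (u : nat -> W) (z : nat -> K) n (c : R) :
  (forall i, (u i < u i.+1)%O) -> (forall i, modulus (z i) <= c) ->
  rnorm (\sum_(i < n) z i *: (cut (u i.+1) - cut (u i))) <=
  n.+1%:R `^ p^-1 * (c + c).
Proof.
move=> ui zc; apply: rnorm_le.
have u_homo : {homo u : i j / (i <= j)%N >-> (i <= j)%O}.
  move=> i j /subnK <-; elim: (j - i)%N => //= l ih.
  exact: le_trans ih (ltW (ui _)).
(* The counter f is 0 up to [u 0], i+1 on []u i, u i.+1]] for i < n, and the default n+1 of [find]
   beyond [u n]. *)
pose f b := find (fun i => (b <= u i)%O) (iota 0 n.+1).
have fE b i : (i <= n)%N -> (b <= u i)%O = (f b <= i)%N.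
  move=> ilen; have [fbi|] := leqP (f b) i; last first.
    move=> /(before_find 0%N); rewrite nth_iota// add0n => ->//.
  apply: le_trans (u_homo _ _ fbi).
  have hasb : has (fun i => (b <= u i)%O) (iota 0 n.+1).
    by rewrite has_find size_iota ltnS (leq_trans fbi).
  have := nth_find 0%N hasb; rewrite nth_iota ?add0n//.
  by rewrite -[X in (_ < X)%N](size_iota 0 n.+1) -has_find.
have fn b : (f b <= n.+1)%N by rewrite -[X in (_ <= X)%N](size_iota 0) find_size.
apply: (@pvariation_step _ _ _ p1 _ _ _ f
    (fun m => if m is i.+1 then if (i < n)%N then z i else 0 else 0)) => //.
- move=> a b ab; have [fbn|nfb] := leqP (f b) n; last exact: leq_trans (fn a) nfb.
  by rewrite -fE// (le_trans ab)// fE.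
- have c0 : 0 <= c by apply: le_trans (zc 0%N); exact: modulus_ge0.
  by case=> [|i]; rewrite ?modulus0//; case: ifP; rewrite ?modulus0.
move=> b; rewrite (@long_James_sumE n (fun i => z i *: (cut (u i.+1) - cut (u i)))).
under eq_bigr => i _.
  rewrite long_James_scaleE long_James_addE long_James_oppE !cutE !fE//; last by rewrite ltnW.
  over.
rewrite [RHS]/=; case: (f b) => [|m].
  by rewrite big1// => i _; rewrite subrr mulr0.
case: ifPn => [mn|]; last first.
  rewrite -leqNgt => nm; rewrite big1// => i _.
  have im : (i < m)%N by apply: leq_trans nm; exact: ltn_ord.
  by rewrite ltnS (ltn_geF im) (leq_gtF (ltnW im)) subrr mulr0.
rewrite (bigD1 (Ordinal mn))//= ltnSn ltnn subr0 mulr1 big1 ?addr0// => i im.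
rewrite ltnS; have [mi|im'|mi] := ltngtP m i; rewrite ?subrr ?mulr0//.
by move: im; rewrite -val_eqE/= mi eqxx.
Qed.

End LongJamesElements.

(** * Density of the span of the functions [cut a] *)

Section Density.
Context {R : realType} {k : scalar_kind} {p : R} {p1 : 1 < p}.
Context {d : Order.disp_t} {W : omega1Type d}.
Local Notation K := (scalar_field R k).
Local Notation J := (long_James_space k p1 W).
Implicit Types (x y : J) (a b c : W).

Let p0 : 0 < p. Proof. exact: lt_trans p1. Qed.

Let pN0 : p != 0. Proof. by rewrite gt_eqF. Qed.

Lemma path_le_last a (s : seq W) : path <=%O a s -> (a <= last a s)%O.
Proof. by elim: s a => //= b s ih a /andP[ab /ih]; exact: le_trans. Qed.

(* Otherwise disjoint chains of variation delta accumulate below a, against the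
   finiteness of the p-variation. *)
Lemma tail_vsum_lt x a (delta : R) : is_limit a -> 0 < delta ->
  exists2 b, (b < a)%O & forall c s, (b <= c)%O -> path <=%O c s ->
    (last c s < a)%O -> vsum (p := p) x c s <= delta.
Proof.
move=> [[b0 b0a] _] delta0; apply: contrapT => /forall2NP h.
have many n b : (b < a)%O -> exists c s, [/\ (b <= c)%O, path <=%O c s,
    (last c s < a)%O & n%:R * delta <= vsum (p := p) x c s].
  elim: n b => [|n ih] b ba; first by exists b, [::]; rewrite mul0r.
  have [|/existsNP[c /existsNP[s hcs]]] := h b; first by move/(_ ba).
  have [bc [cs [sa /negP]]] : (b <= c)%O /\ path <=%O c s /\ (last c s < a)%O /\
      ~ vsum (p := p) x c s <= delta.
    by move: hcs => /not_implyP[? /not_implyP[? /not_implyP[? ?]]].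
  rewrite -ltNge => big; have [c' [s' [cc' cs' sa' big']]] := ih _ sa.
  exists c, (s ++ c' :: s'); split; rewrite ?cat_path ?last_cat//=.
    by rewrite cs cc'.
  rewrite vsum_cat /= -natr1 mulrDl mul1r addrC lerD ?(ltW big)//.
  by rewrite (le_trans big')// lerDr powR_ge0.
have [c [s [_ cs _ big]]] := many (Num.bound (rnorm x `^ p / delta)) _ b0a.
have := archi_boundP (divr_ge0 (powR_ge0 (rnorm x) p) (ltW delta0)).
rewrite ltr_pdivrMr// => /lt_le_trans/(_ big).
by rewrite ltNge long_James_vsum.
Qed.

(** A chain that reaches a has one more jump, from its last point below a. By left continuity this
    jump is a limit of jumps ending below a, and it costs a second delta. *)
Lemma tail_vsum x a (delta : R) : is_limit a -> 0 < delta ->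
  exists2 b, (b < a)%O & forall c s, (b <= c)%O -> path <=%O c s ->
    (last c s <= a)%O -> vsum (p := p) x c s <= delta + delta.
Proof.
move=> la delta0; have [b ba bP] := tail_vsum_lt x la delta0.
exists b => // c s bc /(vsum_weak p1 x)[t [ct <- ->]].
have d2 : delta <= delta + delta by rewrite lerDr ltW.
have weak e u : path <%O e u -> path <=%O e u by apply: sub_path => ? ?; exact: ltW.
case/lastP: t ct => [_ _|t e]; first by rewrite addr_ge0 ?ltW.
rewrite last_rcons le_eqVlt => cte /orP[/eqP ea|ea]; last first.
  by rewrite (le_trans _ d2)// bP//; [exact: weak|rewrite last_rcons].
move: cte; rewrite ea rcons_path -cats1 vsum_cat /= addr0 => /andP[ct ta].
rewrite lerD//; first by rewrite bP//; exact: weak.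
have bt : (b <= last c t)%O by rewrite (le_trans bc)// path_le_last// weak.
set l := last c t in ta bt *.
have -> : delta = (delta `^ p^-1) `^ p by rewrite -powRrM mulVf// powRr1// ltW.
apply: ge0_ler_powR; rewrite ?(ltW p0) ?nnegrE ?modulus_ge0 ?powR_ge0//.
apply/ler_addgt0Pl => r r0; have [b' ba' b'P] := long_James_left x r0 la.
have [f] : exists2 f, (Order.max b' l < f)%O & (f < a)%O.
  by apply: la.2; rewrite gt_max ba' ta.
rewrite gt_max => /andP[b'f lf] fa.
have -> : x a - x l = (x a - x f) + (x f - x l) by rewrite subrKA.
apply: le_trans (modulusD _ _) _; rewrite lerD//.
  by rewrite modulusB_sym b'P// ltW.
have := bP l [:: f] bt; rewrite /= (ltW lf) addr0 => /(_ isT fa) h.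
have -> : modulus (x f - x l) = (modulus (x f - x l) `^ p) `^ p^-1.
  by rewrite -powRrM mulfV// powRr1// modulus_ge0.
by apply: ge0_ler_powR; rewrite ?invr_ge0 ?(ltW p0) ?nnegrE ?powR_ge0 ?(ltW delta0).
Qed.

Definition clamp a b c : W := Order.max a (Order.min c b).

Lemma clamp_homo a b : {homo clamp a b : c e / (c <= e)%O}.
Proof.
move=> c e ce; rewrite /clamp ge_max !le_max lexx/= le_min !ge_min ce lexx.
by rewrite !orbT.
Qed.

Lemma clamp_continuous a b : continuous (clamp a b).
Proof.
apply: (@max_fun_continuous _ _ _ (fun=> a) (Order.min^~ b)).
  by move=> c; exact: cvg_cst.
apply: (@min_fun_continuous _ _ _ id (fun=> b)) => c; [exact: cvg_id|exact: cvg_cst].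
Qed.

Lemma clampE a b c : (a <= b)%O ->
  clamp a b c = if (c <= a)%O then a else if (c <= b)%O then c else b.
Proof.
move=> ab; rewrite /clamp; case: leP => ca.
  by rewrite max_l// ge_min ca.
by case: leP => cb; rewrite max_r// ltW.
Qed.

Lemma clamp_vsum x a b (r : R) : 0 <= r -> (a <= b)%O ->
  (forall c s, (a <= c)%O -> path <=%O c s -> (last c s <= b)%O ->
    vsum (p := p) x c s <= r `^ p) ->
  (pvariation p (fun c => x (clamp a b c) - x b)%R <= r%:E)%E.
Proof.
move=> r0 ab xr; apply: (pvariation_le_vsum p1 r0) => c s cs.
rewrite (eq_vsum _ _ (y := x \o clamp a b)); last first.
  by move=> e f /=; rewrite opprB addrA subrK.
rewrite vsum_comp; apply: xr; first by rewrite le_max lexx.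
  apply: homo_path cs; move=> e f /ltW; exact: clamp_homo.
by rewrite last_map /clamp ge_max ab ge_min lexx orbT.
Qed.

Lemma clamp_mem x a b : (a <= b)%O ->
  (fun c => x (clamp a b c) - x b) \in long_James k p W.
Proof.
move=> ab; apply: (@long_James_mem _ _ _ _ _ _ (rnorm x)).
- move=> c; apply: cvgB; last exact: cvg_cst.
  by apply: continuous_comp; [exact: clamp_continuous|exact: long_James_cont].
- exists b => c bc; rewrite clampE// leNgt (le_lt_trans ab bc)/= leNgt bc/=.
  by rewrite subrr.
- apply: clamp_vsum => // [|c s _ cs _]; first exact: rnorm_ge0.
  exact: long_James_vsum.
Qed.

(** It carries the variation of x on [a, b] only, and segments over adjacent intervals add up. *)
Definition segment x a b (ab : (a <= b)%O) : J := LongJamesSpace p1 (clamp_mem x ab).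

Lemma segmentE x a b (ab : (a <= b)%O) c : segment x ab c =
  if (c <= a)%O then x a - x b else if (c <= b)%O then x c - x b else 0.
Proof. by rewrite /= clampE//; case: ifP => // _; case: ifP => //; rewrite subrr. Qed.

(** Density in dual form. By transfinite induction on e, f kills the segment of x over [0, e]: a
    successor step adds a multiple of a [cut], and at a limit the remaining tail has arbitrarily
    small norm. *)
Lemma cut_total (f : J -> K) (C : R) :
  {morph f : x y / x + y} -> (forall z x, f (z *: x) = z * f x) ->
  (forall x, modulus (f x) <= C * rnorm x) ->
  (forall a, f (cut a) = 0) -> forall x, f x = 0.
Proof.
move=> fD fZ fC fcut x.
have [w0 _ w0min] := @omega1_min d W setT omega1_inhabited.
have {}w0min a : (w0 <= a)%O by exact: w0min.
have initE a c : segment x (w0min a) c = if (c <= a)%O then x c - x a else 0.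
  rewrite segmentE; case: (leP c w0) => // co.
  have -> : c = w0 by apply/le_anti; rewrite co w0min.
  by rewrite w0min.
have [a xa] := long_James_eventually0 x.
(* Strictly beyond a, x is known to vanish; hence x b = 0 and x is its own segment over [0, b]. *)
have [b ab] := omega1_unbounded a.
suff init0 e : f (segment x (w0min e)) = 0.
  rewrite -(init0 b); congr f; apply: long_JamesE => c.
  rewrite initE (xa _ ab) subr0; case: leP => // bc.
  by rewrite xa// (lt_trans ab).
elim/(@omega1_ind d W): e => e ih.
have f0 : f 0 = 0 by rewrite -(scale0r (0 : J)) fZ mul0r.
have [emin|g eg gmin|elim_] := limitP e.
- have -> // : segment x (w0min e) = 0.
  apply: long_JamesE => c; rewrite initE long_James_zeroE; case: leP => // ce.
  by have -> : c = e; rewrite ?subrr//; apply/le_anti; rewrite ce emin.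
- have -> : segment x (w0min e) = segment x (w0min g) + (x g - x e) *: cut g.
    apply: long_JamesE => c.
    rewrite long_James_addE long_James_scaleE !initE cutE.
    case: (leP c g) => cg; first by rewrite (le_trans cg (ltW eg)) mulr1 subrKA.
    rewrite mulr0 addr0; case: leP => // ce.
    by have -> : c = e; rewrite ?subrr//; apply/le_anti; rewrite ce gmin.
  by rewrite fD ih// fZ fcut mulr0 addr0.
(* The tail will have norm at most r', where [|C| * r' <= r]; the summand 1 in r' avoids division by
   0. The bound on the tail comes doubled, whence the half of the p-th power of r'. *)
apply: modulus_small_eq0 => r r0.
pose r' := r / (`|C| + 1).
have r'0 : 0 < r' by rewrite divr_gt0// ltr_wpDl.
have [|g eg gP] := @tail_vsum x e (r' `^ p / 2) elim_.
  by rewrite divr_gt0// powR_gt0.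
have -> : segment x (w0min e) = segment x (w0min g) + segment x (ltW eg).
  apply: long_JamesE => c; rewrite long_James_addE (segmentE x (ltW eg)) !initE.
  case: (leP c g) => cg; last by rewrite add0r.
  by rewrite (le_trans cg (ltW eg)) subrKA.
rewrite fD ih// add0r (le_trans (fC _))//.
have rnr : rnorm (segment x (ltW eg)) <= r'.
  apply: rnorm_le; apply: clamp_vsum (ltW eg) _ => [|c s gc cs sl]; first exact: ltW.
  by rewrite [leRHS]splitr gP.
apply: (@le_trans _ _ (`|C| * r')).
  apply: (@le_trans _ _ (`|C| * rnorm (segment x (ltW eg)))).
    by rewrite ler_wpM2r ?rnorm_ge0// ler_norm.
  by rewrite ler_wpM2l.
rewrite /r' mulrCA -[leRHS]mulr1 ler_wpM2l ?(ltW r0)//.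
by rewrite ler_pdivrMr ?ltr_wpDl// mul1r lerDl.
Qed.

End Density.

(** * Composition operators, and the rows and columns of an operator *)

Section Operators.
Context {R : realType} {k : scalar_kind} {p : R} {p1 : 1 < p}.
Context {d : Order.disp_t} {W : omega1Type d}.
Local Notation K := (scalar_field R k).
Local Notation J := (long_James_space k p1 W).
Local Notation B := (bounded_operator J).
Implicit Types (x y : J) (a b c : W) (S T : B).

Let p0 : 0 < p. Proof. exact: lt_trans p1. Qed.

Let pN0 : p != 0. Proof. by rewrite gt_eqF. Qed.

Definition bnorm S : R := modulus `|S|.

Lemma bnorm_ge0 S : 0 <= bnorm S. Proof. exact: modulus_ge0. Qed.

Lemma rnorm_bop S x : rnorm (S x) <= bnorm S * rnorm x.
Proof.
have SE : operator_norm S = of_real k (bnorm S).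
  by rewrite /bnorm of_real_modulus normr_id.
by have := le_operator_norm S x; rewrite SE !normE -of_realM of_real_le.
Qed.

Lemma bop_bounded (F : J -> J) (C : R) : linear F ->
  (forall x, rnorm (F x) <= C * rnorm x) -> F \in bounded_linear J J.
Proof.
move=> Fl FC; apply/bounded_linearP; split=> //; exists (of_real k C) => x.
by rewrite !normE -of_realM of_real_le.
Qed.

(** That f tends to omega_1, so that [x \o f] still vanishes eventually. *)
Definition unbounded (f : W -> W) := forall a, exists b, forall c, (b < c)%O -> (a < f c)%O.

Lemma comp_pvariation x (f : W -> W) : {homo f : a b / (a <= b)%O} ->
  (pvariation p (x \o f) <= (rnorm x)%:E)%E.
Proof.
move=> fh; apply: (pvariation_le_vsum p1 (rnorm_ge0 x)) => c s cs.
rewrite vsum_comp; apply: long_James_vsum; apply: homo_path cs.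
by move=> a b /ltW; exact: fh.
Qed.

Section Composition.
Variables (f : W -> W) (fh : {homo f : a b / (a <= b)%O}).
Hypotheses (fc : continuous f) (fu : unbounded f).

Lemma comp_mem x : x \o f \in long_James k p W.
Proof.
apply: (long_James_mem _ _ (comp_pvariation x fh)).
  by move=> a; apply: continuous_comp; [exact: fc|exact: long_James_cont].
have [a xa] := long_James_eventually0 x; have [b fb] := fu a.
by exists b => c /fb /xa.
Qed.

Definition comp_fun x : J := LongJamesSpace p1 (comp_mem x).

Lemma comp_fun_bounded : comp_fun \in bounded_linear J J.
Proof.
apply: (@bop_bounded _ 1) => [z x y|x]; first exact: long_JamesE.
by rewrite mul1r; exact/rnorm_le/comp_pvariation.
Qed.

Definition composition : B := BoundedOperator comp_fun_bounded.

Lemma rnorm_composition x : rnorm (composition x) <= rnorm x.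
Proof. exact/rnorm_le/comp_pvariation. Qed.

End Composition.

Fact idop_bounded : (id : J -> J) \in bounded_linear J J.
Proof. by apply: (@bop_bounded _ 1) => // x; rewrite mul1r. Qed.

Definition idop : B := BoundedOperator idop_bounded.

Lemma bop_sumE S (z : nat -> K) (x : nat -> J) n a :
  S (\sum_(i < n) z i *: x i) a = \sum_(i < n) z i * S (x i) a.
Proof.
rewrite linear_sum.
rewrite (@long_James_sumE _ _ _ _ _ _ n (fun i => S (z i *: x i))).
by apply: eq_bigr => i _; rewrite linearZ.
Qed.

(** As p > 1, the exponent 1 - 1/p is positive; if the inequality failed for every n, the powers of
    n+1 with this exponent would stay bounded. *)
Lemma lt_powR_linear (M : R) : exists n : nat, M * n.+1%:R `^ p^-1 < n%:R.
Proof.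
apply: contrapT => /forallNP h.
have q0 : 0 < 1 - p^-1 by rewrite subr_gt0 invf_lt1.
have {}h n : n.+1%:R `^ (1 - p^-1) <= 2 * `|M| + 1.
  have n0 : (0 : R) < n.+1%:R by [].
  have nq : 0 < n.+1%:R `^ p^-1 :> R by rewrite powR_gt0.
  rewrite -(ler_pM2r nq) -powRD ?subrK ?oner_eq0// powRr1//.
  have /negP := h n; rewrite -leNgt => hn.
  have hM : n%:R <= `|M| * n.+1%:R `^ p^-1.
    by rewrite (le_trans hn)// ler_wpM2r ?powR_ge0// ler_norm.
  have n1 : 1 <= n.+1%:R `^ p^-1 :> R.
    have {1}-> : 1 = 1 `^ p^-1 :> R by rewrite powR1.
    apply: ge0_ler_powR; rewrite ?invr_ge0 ?(ltW p0) ?nnegrE//.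
    by rewrite ler1n.
  rewrite -[leLHS]natr1 mulrDl mul1r lerD//.
  rewrite (le_trans hM)// ler_wpM2r ?powR_ge0//.
  by rewrite ler_peMl// ler1n.
have M0 : 0 <= 2 * `|M| + 1 by rewrite addr_ge0// mulr_ge0.
have := archi_boundP (powR_ge0 (2 * `|M| + 1) (1 - p^-1)^-1).
set n := Num.bound _ => hn.
have : n.+1%:R <= (2 * `|M| + 1) `^ (1 - p^-1)^-1.
  have -> : n.+1%:R = (n.+1%:R `^ (1 - p^-1)) `^ (1 - p^-1)^-1 :> R.
    by rewrite -powRrM mulfV ?gt_eqF// powRr1.
  by apply: ge0_ler_powR; rewrite ?invr_ge0 ?(ltW q0) ?nnegrE ?powR_ge0.
by rewrite leNgt (lt_trans hn)// ltr_nat.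
Qed.

(** Were there infinitely many jumps of size e in the row, n blocks scaled by the inverse jumps
    would give an x of norm of order n^(1/p) with [S x a = n]. *)
Lemma row_eventually_constant S a :
  exists b, forall c, (b < c)%O -> S (cut c) a = S (cut b) a.
Proof.
apply: (@eventually_constant _ _ _ _ (fun b => S (cut b) a)) => e e0 u ui ue.
(* With this coefficient each block contributes exactly 1 to S x at a. *)
pose z i := (S (cut (u i.+1)) a - S (cut (u i)) a)^-1.
have zc i : modulus (z i) <= e^-1.
  rewrite modulusV.
  by rewrite lef_pV2 ?posrE// (lt_le_trans e0).
have [n] := lt_powR_linear (bnorm S * (e^-1 + e^-1)).
apply/negP; rewrite -leNgt.
pose x := \sum_(i < n) z i *: (cut (u i.+1) - cut (u i)) : J.
have xn : S x a = n%:R.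
  rewrite (bop_sumE _ _ (fun i => cut (u i.+1) - cut (u i))).
  rewrite (eq_bigr (fun=> 1)) ?sumr_const ?card_ord// => i _.
  rewrite linearB long_James_addE long_James_oppE mulVf//.
  by apply/eqP => z0; have := ue i; rewrite z0 modulus0 leNgt e0.
rewrite -(modulus_nat (k := k) n) -xn.
apply: le_trans (long_James_eval _ _) _; apply: le_trans (rnorm_bop _ _) _.
rewrite -mulrA ler_wpM2l ?bnorm_ge0// mulrC.
exact: rnorm_blocks.
Qed.

(** Membership in the set M: all rows from some point on have limit 0. *)
Definition negligible S :=
  exists a, forall b, (a < b)%O -> exists c, forall e, (c < e)%O -> S (cut e) b = 0.

(** On a finite chain the function r of row limits agrees with a single column, so its p-variation
    is at most that of the columns. It is thus eventually constant, and z is its final value. *)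
Lemma scalar_plus_negligible S : exists z : K,
  modulus z <= bnorm S * 2 /\ negligible (S - z *: idop).
Proof.
have [g gP] := choice (fun a => row_eventually_constant S a).
pose r a := S (cut (g a)) a.
have common a (s : seq W) : exists b, forall c, c \in a :: s -> S (cut b) c = r c.
  suff [b bP] : exists b, forall c, c \in a :: s -> (g c < b)%O.
    by exists b => c /bP /gP.
  have [|b bP] := @omega1_countable_bounded d W [set g c | c in [set` a :: s]].
    by apply/finite_set_countable/finite_image.
  by exists b => c cs; apply: bP; exists c.
have C0 : 0 <= bnorm S * 2 by rewrite mulr_ge0 ?bnorm_ge0.
have cutC b : rnorm (S (cut b)) <= bnorm S * 2.
  by apply: le_trans (rnorm_bop _ _) _; rewrite ler_wpM2l ?bnorm_ge0 ?rnorm_cut.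
have rP : (pvariation p r <= (bnorm S * 2)%:E)%E.
  apply: (pvariation_le_vsum p1 C0) => a s as_; have [b bP] := common a s.
  have -> : vsum (p := p) r a s = vsum (p := p) (S (cut b)) a s.
    elim: s a bP {as_} => //= c s ih a bP.
    rewrite ih => [|e es]; last by rewrite bP// inE es orbT.
    by rewrite !bP ?inE ?eqxx ?orbT.
  have weak : path <=%O a s by apply: sub_path as_ => ? ?; exact: ltW.
  by apply: (vsum_le_pvariation p1) weak; rewrite pvariationE lee_fin.
have [a ra] : exists a, forall b, (a < b)%O -> r b = r a.
  apply: eventually_constant => e e0 u ui ue.
  have big n : n%:R * e `^ p <= (bnorm S * 2) `^ p.
    have pathu : path <=%O (u 0%N) [seq u i | i <- iota 1 n].
      by apply: (@sub_path _ <%O) => [? ?|]; [exact: ltW|apply: path_iota].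
    apply: le_trans (vsum_le_pvariation p1 rP pathu); rewrite vsum_iota.
    apply: (@le_trans _ _ (\sum_(i < n) e `^ p)).
      by rewrite sumr_const card_ord mulr_natl.
    apply: ler_sum => i _; rewrite add0n.
    by apply: ge0_ler_powR; rewrite ?(ltW p0) ?nnegrE ?modulus_ge0 ?(ltW e0).
  have := archi_boundP (divr_ge0 (powR_ge0 (bnorm S * 2) p) (powR_ge0 e p)).
  by rewrite ltr_pdivrMr ?powR_gt0// ltNge big.
exists (r a); split; first exact: le_trans (long_James_eval _ _) (cutC _).
exists a => b ab; exists (Order.max b (g b)) => c; rewrite gt_max => /andP[bc gc].
rewrite -[(S - _) _]/(S (cut c) - r a *: cut c).
rewrite long_James_addE long_James_oppE long_James_scaleE cutE (ltW bc) mulr1.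
by rewrite gP// -/(r b) ra// subrr.
Qed.

(** Closing off: a is the supremum of points [u i] such that columns up to [u i] vanish beyond
    [u i.+1], and row [u i] vanishes at columns beyond [u i.+1]. At a, a column b < a vanishes
    directly, and a column b >= a by left continuity; density of the span gives all x. *)
Lemma vanishing_unbounded (S : nat -> B) : (forall n, negligible (S n)) ->
  forall a0, exists2 a, (a0 < a)%O & forall n x, S n x a = 0.
Proof.
move=> Sn a0.
have /choice[al alP] n : exists a, forall b, exists c, (a < b)%O ->
    forall e, (c < e)%O -> S n (cut e) b = 0.
  have [a aP] := Sn n; exists a => b; have [/aP[c cP]|ab] := ltP a b.
    by exists c.
  by exists b.
have /choice[g gP] n : exists g : W -> W, forall b, (al n < b)%O ->
    forall e, (g b < e)%O -> S n (cut e) b = 0.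
  by have [g gP] := choice (alP n); exists g.
have /choice[h hP] n : exists h : W -> W, forall b e, (h b < e)%O ->
    S n (cut b) e = 0.
  have [h hP] := choice (fun b => long_James_eventually0 (S n (cut b))).
  by exists h.
(* A single m bounds the thresholds of all the operators, which are countably many. *)
have /choice[m mP] b : exists e, forall n, [/\ (al n < e)%O, (g n b < e)%O & (h n b < e)%O].
  have [e eP] := omega1_seq_bounded (fun n => Order.max (al n) (Order.max (g n b) (h n b))).
  by exists e => n; have := eP n; rewrite !gt_max => /and3P[].
have step a : exists b, (a < b)%O /\ forall c, (c <= a)%O -> (m c < b)%O.
  have [|e eP] := @omega1_countable_bounded d W [set m c | c in [set c | (c <= a)%O]].
    by apply: (sub_countable (card_image_le _ _)); exact: omega1_initial_countable.
  have [e' ee'] := omega1_unbounded (Order.max a e); move: ee'; rewrite gt_max => /andP[ae ee'].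
  by exists e'; split=> // c ca; rewrite (lt_trans _ ee')// eP//; exists c.
have [u [u0 us]] := omega1_iterate step a0.
have [a [la ua cof]] := omega1_sup (fun n => (us n).1).
exists a; first by rewrite -u0.
move=> n.
pose f x := S n x a.
apply: (@cut_total _ _ _ p1 _ _ f (bnorm (S n))).
- by move=> x y; rewrite /f linearD.
- by move=> z x; rewrite /f linearZ.
- by move=> x; apply: le_trans (long_James_eval _ _) _; exact: rnorm_bop.
move=> b; rewrite /f; have [ba|ab] := ltP b a.
  have [i bi] := cof b ba; apply: hP.
  have [_ _ hm] := mP b n; rewrite (lt_trans hm)// (lt_trans _ (ua i.+1))//.
  by apply: (us i).2; exact: ltW.
apply: modulus_small_eq0 => e e0.
have [c ca cP] := long_James_left (S n (cut b)) e0 la.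
(* Past [u 1], the point [u i] lies beyond every [al n], so that row [u i] has limit 0. *)
have [|i] := cof (Order.max c (u 1%N)); first by rewrite gt_max ca ua.
rewrite gt_max => /andP[ci ui].
have := cP _ ci (ltW (ua i)).
rewrite (gP n (u i)) ?sub0r; first by rewrite -modulus_normr normrN modulus_normr.
  have [aln _ _] := mP (u 0%N) n; rewrite (lt_trans aln)// (lt_trans _ ui)//.
  exact: (us 0%N).2.
have [_ gn _] := mP (u i) n.
by rewrite (lt_le_trans _ ab)// (lt_trans gn)// (lt_trans _ (ua i.+1))// (us i).2.
Qed.

End Operators.

(** * Copies of the gaps of a closed unbounded set *)

Section Copies.
Context {d : Order.disp_t} {W : omega1Type d}.
Implicit Types a b c e : W.

Lemma lt_homo_ge (f : W -> W) : {homo f : a b / (a < b)%O} -> forall a, (a <= f a)%O.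
Proof.
move=> fh; elim/(@omega1_ind d W) => a ih; rewrite leNgt; apply/negP => fa.
by have := fh _ _ fa; rewrite ltNge ih.
Qed.

(** If f is constant just before a, continuity is immediate; otherwise f a is a limit itself,
    approached by the earlier values of f. *)
Lemma homo_continuous (f : W -> W) : {homo f : a b / (a <= b)%O} ->
  (forall a, is_limit a -> forall c, (c < f a)%O ->
    exists2 b, (b < a)%O & (c < f b)%O) ->
  continuous f.
Proof.
move=> fh flim; apply: continuous_limit => a la U Ufa.
have [[b ba fba]|fN] := pselect (exists2 b, (b < a)%O & f b = f a).
  exists b => // c bc ca; have -> : f c = f a; last exact: nbhs_singleton.
  by apply/le_anti; rewrite fh//= -fba (fh _ _ (ltW bc)).
have flt b : (b < a)%O -> (f b < f a)%O.
  move=> ba; rewrite lt_neqAle fh ?andbT ?ltW//.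
  by apply/eqP => fba; apply: fN; exists b.
have lfa : is_limit (f a).
  split; first by have [[b ba] _] := la; exists (f b); exact: flt.
  by move=> c /(flim a la)[b ba cb]; exists (f b); rewrite ?flt.
have [c cfa cU] := near_limit Ufa lfa.
have [b ba cb] := flim a la c cfa.
by exists b => // e be ea; apply: cU; rewrite ?fh// (lt_le_trans cb)// fh// ltW.
Qed.

Lemma omega1_least : exists least : set W -> W, forall A, A !=set0 ->
  A (least A) /\ forall a, A a -> (least A <= a)%O.
Proof.
have [w _] := @omega1_inhabited d W.
have /choice[f fP] (A : set W) : exists a, A !=set0 -> A a /\ forall b, A b -> (a <= b)%O.
  have [/omega1_min[a Aa aA]|A0] := pselect (A !=set0); first by exists a.
  by exists w.
by exists f.
Qed.

(** The rank of t is the least strict upper bound of the ranks of its predecessors; it exists in W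
    because these are countably many. The second clause expresses that it is least. *)
Lemma omega1_rank (T : Type) (r : T -> T -> Prop) :
  (forall A : set T, A !=set0 -> exists2 t, A t & forall s, r s t -> ~ A s) ->
  (forall t, countable [set s | r s t]) ->
  exists rank : T -> W, (forall s t, r s t -> (rank s < rank t)%O) /\
    forall t c, (c < rank t)%O -> exists2 s, r s t & (c <= rank s)%O.
Proof.
move=> rmin rcnt.
have rwf : well_founded r.
  move=> t; apply: contrapT => tN.
  have [|s sN smin] := rmin [set t | ~ Acc r t]; first by exists t.
  by apply: sN; constructor => u /smin /contrapT.
have [least leastP] := omega1_least.
pose rank := Fix rwf (fun=> W) (fun t rec =>
  least [set b | forall s (h : r s t), (rec s h < b)%O]).
have rankE t : rank t = least [set b | forall s, r s t -> (rank s < b)%O].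
  rewrite /rank Fix_eq// => {}t f g fg; congr least.
  by apply/seteqP; split=> b h s rst; [rewrite -fg|rewrite fg]; exact: h.
have rankP t : (forall s, r s t -> (rank s < rank t)%O) /\
    forall b, (forall s, r s t -> (rank s < b)%O) -> (rank t <= b)%O.
  rewrite rankE; apply: leastP.
  have [|b bP] := @omega1_countable_bounded d W [set rank s | s in [set s | r s t]].
    by apply: (sub_countable (card_image_le _ _)); exact: rcnt.
  by exists b => s rst; apply: bP; exists s.
exists rank; split=> [s t|t c ct]; first exact: (rankP t).1.
apply: contrapT => h; suff : (rank t <= c)%O by rewrite leNgt ct.
apply: (rankP t).2 => s rst; rewrite ltNge; apply/negP => cs.
by apply: h; exists s.
Qed.

Variable D : set W.
Hypothesis D_unbounded : forall a, exists2 b, (a < b)%O & D b.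

(** At a limit this says that a is an accumulation point of D; it also holds at 0 and at successors
    of points of D. If such an a is in D, its gap is a single point. *)
Let cofinal_below a := forall b, (b < a)%O -> exists c, [/\ D c, (b <= c)%O & (c < a)%O].

Hypothesis D_closed : forall a, is_limit a -> cofinal_below a -> D a.

Lemma next_exists : exists rho : W -> W, forall a, [/\ D (rho a), (a <= rho a)%O
  & forall b, D b -> (a <= b)%O -> (rho a <= b)%O].
Proof.
suff /choice[rho] : forall a, exists c, [/\ D c, (a <= c)%O
    & forall b, D b -> (a <= b)%O -> (c <= b)%O] by exists rho.
move=> a; have [b0 ab0 Db0] := D_unbounded a.
have [|c [Dc ac] cmin] := @omega1_min d W [set c | D c /\ (a <= c)%O].
  by exists b0; split=> //; exact: ltW.
by exists c; split=> // b Db ab; exact: cmin.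
Qed.

(* Every gap (e, rho a] of D is repeated omega times, all the copies of one gap
   preceding those of the next; tau j runs through the j-th copies and
   pi j is the generalised inverse of tau j. Gaps reduced to an accumulation
   point of D are not repeated, which makes tau j continuous. *)
Lemma copies_exist : exists (rho : W -> W) (tau pi : nat -> W -> W),
  [/\ [/\ forall a, D (rho a), {homo rho : a b / (a <= b)%O}, continuous rho &
         forall a, (a <= rho a)%O],
     forall j, {homo tau j : a b / (a < b)%O} /\ continuous (tau j),
     forall j, {homo pi j : a b / (a <= b)%O} /\ continuous (pi j),
     forall j a, pi j (tau j a) = a &
     forall i j a, i != j -> pi j (tau i a) = pi j (tau i (rho a))].
Proof.
have [rho rhoP] := next_exists.
have rhoD a : D (rho a) by case: (rhoP a).
have rho_ge a : (a <= rho a)%O by case: (rhoP a).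
have rho_min a b : D b -> (a <= b)%O -> (rho a <= b)%O by case: (rhoP a) => _ _; exact.
have rho_id a : D a -> rho a = a.
  by move=> Da; apply/le_anti; rewrite rho_ge rho_min.
have rho_homo : {homo rho : a b / (a <= b)%O}.
  by move=> a b ab; rewrite rho_min// (le_trans ab).
have rho_cont : continuous rho.
  apply: homo_continuous => // a la c ca; apply: contrapT => /forall2NP h.
  have rho_c b : (b < a)%O -> (rho b <= c)%O.
    by move=> ba; have [/(_ ba)//|/negP] := h b; rewrite -leNgt.
  have rho_lt b : (b < a)%O -> (rho b < a)%O.
    move=> ba; rewrite ltNge; apply/negP => arho.
    have rab : (rho a <= rho b)%O by apply: rho_min.
    by have := le_lt_trans (le_trans rab (rho_c b ba)) ca; rewrite ltxx.
  have Da : D a.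
    by apply: D_closed => // b ba; exists (rho b); split; rewrite ?rho_lt.
  rewrite rho_id// in ca; have [e ce ea] := la.2 _ ca.
  by have := le_lt_trans (le_trans (rho_ge e) (rho_c e ea)) ce; rewrite ltxx.
have acc_id a : cofinal_below (rho a) -> rho a = a.
  move=> acc; apply/le_anti; rewrite rho_ge andbT leNgt; apply/negP => ar.
  have [c [Dc ac cr]] := acc _ ar.
  by move: cr; rewrite ltNge rho_min.
have gap a : is_limit a -> ~ cofinal_below a -> exists2 b, (b < a)%O & rho b = rho a.
  move=> la /existsNP[b /not_implyP[ba /forallNP h]]; exists b => //.
  apply/le_anti; rewrite (rho_homo _ _ (ltW ba))/= rho_min// leNgt; apply/negP => ra.
  by apply: (h (rho b)).
(* Lexicographic order by gap, copy number and position. In a one-point gap the pairs (j, a) are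
   incomparable and share one rank. *)
pose prec (s t : nat * W) := (rho s.2 < rho t.2)%O \/
  [/\ rho s.2 = rho t.2, ~ cofinal_below (rho t.2) &
    (s.1 < t.1)%N \/ s.1 = t.1 /\ (s.2 < t.2)%O].
have [||rank [rank_lt rank_sup]] := @omega1_rank _ prec.
(* A minimal pair is found by minimising the gap, then the copy number, then the position. *)
- move=> A [t0 At0].
  have [|_ [t1 At1 <-] rmin] := @omega1_min d W [set rho t.2 | t in A].
    by exists (rho t0.2), t0.
  have [|j /asboolP[t2 [At2 rt2 <-]] jmin] :=
      @ex_minnP (fun j => `[< exists t, [/\ A t, rho t.2 = rho t1.2 & t.1 = j] >]).
    by exists t1.1; apply/asboolP; exists t1.
  have [|_ [t3 [At3 rt3 t32] <-] amin] := @omega1_min d W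
      [set t.2 | t in [set t | [/\ A t, rho t.2 = rho t1.2 & t.1 = t2.1]]].
    by exists t2.2, t2.
  exists t3 => // s [st|[rs _ [st|[st1 st2]]]] As.
  - by move: st; rewrite rt3 ltNge rmin//; exists s.
  - move: st; rewrite t32 ltnNge jmin//; apply/asboolP; exists s; split=> //.
    by rewrite rs rt3.
  - by move: st2; rewrite ltNge amin//; exists s => //; split; rewrite ?rs ?rt3 ?st1.
- move=> t; apply: (@sub_countable _ _ _ ([set: nat] `*` [set b | (b <= rho t.2)%O])).
    apply: subset_card_le => s st; split=> //=.
    apply: le_trans (rho_ge s.2) _.
    by case: st => [/ltW|[->]].
  by apply: countableX => //; exact: omega1_initial_countable.
pose tau j a := rank (j, a).
have tau_lt j : {homo tau j : a b / (a < b)%O}.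
  move=> a b ab; apply: rank_lt; have := rho_homo _ _ (ltW ab).
  rewrite le_eqVlt => /orP[/eqP rab|]; [right|by left].
  split=> //=; last by right.
  move=> acc; have rb := acc_id _ acc; rewrite -rab in acc.
  by move: ab; rewrite -rb -rab acc_id// ltxx.
have tau_le j : {homo tau j : a b / (a <= b)%O}.
  by move=> a b; rewrite le_eqVlt => /orP[/eqP->//|/tau_lt/ltW].
have tau_cont j : continuous (tau j).
  apply: homo_continuous => // a la c /rank_sup[[i b] sa cs].
  (* If a is not an accumulation point of D, its gap starts before a and contains such an e;
     otherwise [rho a = a] and e is found between [rho b] and a. *)
  suff [e ea se] : exists2 e, (e < a)%O & prec (i, b) (j, e).
    by exists e => //; exact: le_lt_trans cs (rank_lt _ _ se).
  case: sa => /= [rba|[rba nacc [ij|[-> ba]]]].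
  - have [acc|/(gap _ la)[e ea rea]] := pselect (cofinal_below a); last first.
      by exists e => //; left; rewrite /= rea.
    rewrite (rho_id a (D_closed la acc)) in rba.
    have [e re ea] := la.2 _ rba.
    by exists e => //; left; exact: lt_le_trans re (rho_ge e).
  - have [acc|/(gap _ la)[e ea rea]] := pselect (cofinal_below a).
      by case: nacc; rewrite (rho_id a (D_closed la acc)).
    by exists e => //; right; rewrite /= rea; split=> //; left.
  - have [e be ea] := la.2 _ ba; exists e => //; have := rho_homo _ _ (ltW be).
    rewrite le_eqVlt => /orP[/eqP rbe|]; [right|by left].
    by rewrite /= -rbe rba; split=> //; right.
have [least leastP] := omega1_least.
pose pi j b := least [set a | (b <= tau j a)%O].
have piP j b : (b <= tau j (pi j b))%O /\ forall a, (b <= tau j a)%O -> (pi j b <= a)%O.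
  by apply: leastP; exists b; exact: lt_homo_ge (tau_lt j) b.
have pi_homo j : {homo pi j : a b / (a <= b)%O}.
  by move=> a b ab; apply: (piP j a).2; exact: le_trans ab (piP j b).1.
exists rho, tau, pi; split=> //.
- move=> j; split=> //; apply: homo_continuous => // a la c ca.
  have ta : (tau j c < a)%O.
    by rewrite ltNge; apply/negP => /(piP j a).2; rewrite leNgt ca.
  have [b cb ba] := la.2 _ ta; exists b => //.
  rewrite ltNge; apply/negP => bc.
  by have := le_lt_trans (le_trans (piP j b).1 (tau_le j _ _ bc)) cb; rewrite ltxx.
- move=> j a; apply/le_anti; rewrite (piP j _).2//= leNgt; apply/negP => /(tau_lt j).
  by rewrite ltNge (piP j _).1.
(* No value of [tau j] lies in [[tau i a, tau i (rho a)[], which stays within the i-th copy of one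
   gap. *)
- move=> i j a ij; congr least; apply/seteqP; split=> c /=; last first.
    exact: le_trans (tau_le i _ _ (rho_ge a)).
  have [/acc_id -> //|nacc] := pselect (cofinal_below (rho a)).
  move=> tac; have [rac|rca|rac] := ltgtP (rho a) (rho c).
  - by apply/ltW/rank_lt; left; rewrite /= (rho_id (rho a)).
  - have /rank_lt : prec (j, c) (i, a) by left.
    by rewrite ltNge tac.
  have [iltj|jlti|eij] := ltngtP i j; last by rewrite eij eqxx in ij.
  - apply/ltW/rank_lt; right; rewrite /= (rho_id (rho a))// -rac; split=> //.
    by left.
  - have /rank_lt : prec (j, c) (i, a) by right; split=> //; left.
    by rewrite ltNge tac.
Qed.

End Copies.

(** * Geometric series, uniform limits in J and series of operators *)

Section Limits.

(** The intervals of radius t n around the partial sums s n are nested; the limit is the supremum of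
    their left end points. *)
Lemma geometric_limit (R : realType) (v : nat -> R) (C : R) :
  (forall i, `|v i| <= C * 2^-1 ^+ i) ->
  exists l, forall n, `|\sum_(i < n) v i - l| <= 2 * C * 2^-1 ^+ n.
Proof.
move=> vC.
pose s n := \sum_(i < n) v i; pose t n := 2 * C * 2^-1 ^+ n.
have tS n : t n.+1 = C * 2^-1 ^+ n by rewrite /t exprS; lra.
have tE n : t n = C * 2^-1 ^+ n + C * 2^-1 ^+ n by rewrite /t; lra.
have sS n : s n.+1 = s n + v n by rewrite /s big_ord_recr.
have up n m : s n - t n <= s (n + m)%N - t (n + m)%N.
  elim: m => [|m ih]; first by rewrite addn0.
  rewrite (le_trans ih)// addnS sS tS tE.
  by have := vC (n + m)%N; rewrite ler_norml => /andP[]; lra.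
have down n m : s (n + m)%N + t (n + m)%N <= s n + t n.
  elim: m => [|m ih]; first by rewrite addn0.
  rewrite (le_trans _ ih)// addnS sS tS tE.
  by have := vC (n + m)%N; rewrite ler_norml => /andP[]; lra.
have t0 n : 0 <= t n by rewrite tE addr_ge0// (le_trans _ (vC n)).
have cross n m : s n - t n <= s m + t m.
  apply: le_trans (up n m) _; apply: le_trans (down m n); rewrite addnC.
  by have := t0 (m + n)%N; lra.
pose A := [set s n - t n | n in [set: nat]].
have A0 : A !=set0 by exists (s 0%N - t 0%N), 0%N.
exists (sup A) => n; rewrite -/(s n) -/(t n) ler_norml.
have h1 : s n - t n <= sup A.
  apply: ub_le_sup; last by exists n.
  by exists (s 0%N + t 0%N) => _ [m _ <-].
have h2 : sup A <= s n + t n by apply: ge_sup => // _ [m _ <-].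
by apply/andP; split; lra.
Qed.

Lemma half_pow_small (R : realType) (M e : R) : 0 <= M -> 0 < e ->
  exists n : nat, M * 2^-1 ^+ n <= e.
Proof.
move=> M0 e0; have M1 : 0 < M + 1 by rewrite ltr_wpDl.
have [n ne] := natSinv_lt (divr_gt0 e0 M1); exists n.
apply: (@le_trans _ _ ((M + 1) * n.+1%:R^-1)); last first.
  by rewrite mulrC -ler_pdivlMr// ltW.
apply: ler_pM; rewrite ?exprn_ge0 ?invr_ge0 ?lerDl//.
rewrite exprVn lef_pV2 ?posrE ?exprn_gt0// -natrX ler_nat.
exact: ltn_expl.
Qed.

(** Coordinates for both scalar fields at once, to reduce scalar limits to real ones; over R the
    second coordinate is 0. *)
Lemma scalar_parts (R : realType) (k : scalar_kind) :
  exists (re im : scalar_field R k -> R) (mk : R -> R -> scalar_field R k),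
  [/\ {morph re : x y / x + y}, {morph im : x y / x + y},
      forall z, `|re z| <= modulus z /\ `|im z| <= modulus z &
      forall z a b, modulus (z - mk a b) <= `|re z - a| + `|im z - b|].
Proof.
case: k => /=.
  exists id, (fun=> 0), (fun a _ => a); split=> [//|x y|z|z a b].
  - by rewrite addr0.
  - by rewrite normr0.
  - by rewrite lerDl.
exists (@complex.Re R), (@complex.Im R), (@Complex R); split.
- by move=> [a b] [a' b'].
- by move=> [a b] [a' b'].
- move=> [a b] /=; rewrite -!sqrtr_sqr !ler_sqrt ?addr_ge0 ?sqr_ge0//.
  by rewrite lerDl lerDr !sqr_ge0.
- move=> [a b] a' b' /=.
  rewrite -[leRHS]ger0_norm ?addr_ge0// -sqrtr_sqr ler_sqrt ?sqr_ge0//.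
  rewrite -(real_normK (num_real (a - a'))) -(real_normK (num_real (b - b'))).
  by rewrite [leRHS]sqrrD addrAC lerDl mulrn_wge0// mulr_ge0.
Qed.

Lemma scalar_limit (R : realType) (k : scalar_kind) (v : nat -> scalar_field R k) (C : R) :
  (forall i, modulus (v i) <= C * 2^-1 ^+ i) ->
  exists l, forall n, modulus (\sum_(i < n) v i - l) <= 4 * C * 2^-1 ^+ n.
Proof.
move=> vC; have [re [im [mk [reD imD reim mkP]]]] := scalar_parts R k.
have sumE (f : scalar_field R k -> R) : {morph f : x y / x + y} ->
    forall n, f (\sum_(i < n) v i) = \sum_(i < n) f (v i).
  move=> fD; have f0 : f 0 = 0 by apply: (addIr (f 0)); rewrite -fD !add0r.
  by elim=> [|n ih]; rewrite ?big_ord0// !big_ord_recr fD ih.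
have [|a aP] := @geometric_limit R (re \o v) C.
  by move=> i; exact: le_trans (reim _).1 (vC i).
have [|b bP] := @geometric_limit R (im \o v) C.
  by move=> i; exact: le_trans (reim _).2 (vC i).
exists (mk a b) => n; apply: le_trans (mkP _ _ _) _.
rewrite !sumE//.
apply: le_trans (lerD (aP n) (bP n)) _.
by rewrite le_eqVlt; apply/orP; left; apply/eqP; lra.
Qed.

Context {R : realType} {k : scalar_kind} {p : R} {p1 : 1 < p}.
Context {d : Order.disp_t} {W : omega1Type d}.
Local Notation K := (scalar_field R k).
Local Notation J := (long_James_space k p1 W).
Local Notation B := (bounded_operator J).

Let p0 : 0 < p. Proof. exact: lt_trans p1. Qed.

Let pN0 : p != 0. Proof. by rewrite gt_eqF. Qed.

(** On a chain with n jumps, a uniform error e changes each jump by at most 2e, which by Minkowski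
    costs at most 2e n^(1/p). *)
Lemma pvariation_limit (x : nat -> J) (f : W -> K) (C : R) :
  (forall n, rnorm (x n) <= C) ->
  (forall e : R, 0 < e -> exists n, forall a, modulus (x n a - f a) <= e) ->
  (pvariation p f <= C%:E)%E.
Proof.
move=> xC xf; apply: pvariation_le => n u un; rewrite lee_fin.
suff h (r : R) : 0 < r -> chain_sum p f n u <= C + r.
  by apply/ler_addgt0Pl => r r0; rewrite addrC; exact: h.
(* This e makes 2e n^(1/p) at most r; the summand 1 keeps the denominator positive. *)
move=> r0; pose e : R := r / (2 * (n%:R `^ p^-1 + 1)).
have q0 : 0 < 2 * (n%:R `^ p^-1 + 1) :> R by rewrite mulr_gt0// ltr_wpDl ?powR_ge0.
have e0 : 0 < e by rewrite divr_gt0.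
have [m xm] := xf e e0.
pose v i := modulus (x m (u i.+1) - x m (u i)).
have v0 i : 0 <= v i by exact: modulus_ge0.
have e2 (i : nat) : 0 <= e + e by rewrite addr_ge0 ?ltW.
have pe0 : 0 <= p^-1 by rewrite invr_ge0 ltW.
have mono : chain_sum p f n u <= (\sum_(i < n) (v i + (e + e)) `^ p) `^ p^-1.
  have sum_ge0 (w : nat -> R) : 0 <= \sum_(i < n) w i `^ p.
    by apply: sumr_ge0 => i _; exact: powR_ge0.
  apply: ge0_ler_powR => //.
  - exact: (sum_ge0 (fun i => modulus (f (u i.+1) - f (u i)))).
  - exact: (sum_ge0 (fun i => v i + (e + e))).
  apply: ler_sum => i _; apply: ge0_ler_powR; rewrite ?(ltW p0) ?nnegrE ?modulus_ge0//.
    by rewrite addr_ge0 ?e2.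
  have -> : f (u i.+1) - f (u i) = (x m (u i.+1) - x m (u i)) +
      ((x m (u i) - f (u i)) + (f (u i.+1) - x m (u i.+1))).
    by ring.
  apply: le_trans (modulusD _ _) _; rewrite lerD//.
  apply: le_trans (modulusD _ _) _; rewrite lerD//.
  by rewrite modulusB_sym.
apply: le_trans mono _; apply: le_trans (minkowski_sum p1 n v0 e2) _.
apply: lerD.
  apply: le_trans (xC m); rewrite -lee_fin -pvariationE.
  exact: (le_pvariation p (x m) un).
rewrite sumr_const card_ord -mulr_natl powRM ?powR_ge0//.
rewrite -powRrM mulfV// powRr1 ?e2//.
have -> : r = e * (2 * (n%:R `^ p^-1 + 1)) by rewrite /e divfK// gt_eqF.
have -> : e * (2 * (n%:R `^ p^-1 + 1)) = n%:R `^ p^-1 * (e + e) + (e + e) by ring.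
by rewrite lerDl e2.
Qed.

Lemma long_James_limit (x : nat -> J) (f : W -> K) (C : R) :
  (forall n, rnorm (x n) <= C) ->
  (forall e : R, 0 < e -> exists n, forall a, modulus (x n a - f a) <= e) ->
  f \in long_James k p W.
Proof.
move=> xC xf; apply: long_James_mem (pvariation_limit xC xf).
  apply: continuous_left => a la e e0.
  have e3 : 0 < e / 3 by rewrite divr_gt0.
  have [n xn] := xf _ e3; have [b ba bP] := long_James_left (x n) e3 la.
  exists b => // c bc ca.
  have -> : f c - f a = (f c - x n c) + ((x n c - x n a) + (x n a - f a)) by ring.
  have -> : e = e / 3 + (e / 3 + e / 3) by field.
  apply: le_trans (modulusD _ _) _; rewrite lerD//; first by rewrite modulusB_sym.
  by apply: le_trans (modulusD _ _) _; rewrite lerD// bP.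
have [u uP] := choice (fun n => long_James_eventually0 (x n)).
have [b ub] := omega1_seq_bounded u.
exists b => c bc; apply: modulus_small_eq0 => e /xf[n /(_ c)].
rewrite uP; first by rewrite sub0r -modulus_normr normrN modulus_normr.
exact: lt_trans (ub n) bc.
Qed.

Lemma rnormD (x y : J) : rnorm (x + y) <= rnorm x + rnorm y.
Proof.
by have := long_James_normD x y; rewrite /long_James_norm -of_realD of_real_le.
Qed.

Lemma rnormZ (z : K) (x : J) : rnorm (z *: x) = modulus z * rnorm x.
Proof.
apply: (@of_real_inj _ k); rewrite of_realM of_real_modulus.
exact: long_James_normZ.
Qed.

(** The series is summed at each point. Its partial sums have norm at most [2 * rnorm x] and
    converge uniformly in a, so that the limit function is again in J. *)
Lemma operator_series (Z : nat -> B) :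
  (forall i x, rnorm (Z i x) <= rnorm x * 2^-1 ^+ i) ->
  exists T : B, forall x a n,
    modulus (\sum_(i < n) Z i x a - T x a) <= 4 * rnorm x * 2^-1 ^+ n.
Proof.
move=> ZP.
have /choice[g gP] (xa : J * W) : exists l, forall n,
    modulus (\sum_(i < n) Z i xa.1 xa.2 - l) <= 4 * rnorm xa.1 * 2^-1 ^+ n.
  apply: (@scalar_limit _ _ (fun i => Z i xa.1 xa.2) (rnorm xa.1)) => i.
  exact: le_trans (long_James_eval _ _) (ZP _ _).
pose s x n := \sum_(i < n) Z i x.
have sE x n a : s x n a = \sum_(i < n) Z i x a by rewrite (long_James_sumE n (fun i => Z i x)).
have snorm x n : rnorm (s x n) <= 2 * rnorm x.
  (* The exact partial sum of the geometric series serves as induction hypothesis. *)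
  apply: (@le_trans _ _ (rnorm x * (2 - 2 * 2^-1 ^+ n))); last first.
    by rewrite mulrC ler_wpM2r ?rnorm_ge0// lerBlDr lerDl mulr_ge0 ?exprn_ge0.
  elim: n => [|n ih].
    rewrite /s big_ord0 expr0 mulr1 subrr mulr0 le_eqVlt; apply/orP; left.
    by apply/eqP/(@of_real_inj _ k); rewrite -normE normr0 of_real0.
  rewrite /s big_ord_recr; apply: le_trans (rnormD _ _) _.
  apply: le_trans (lerD ih (ZP n x)) _; set q : R := 2^-1 ^+ n.
  have -> : 2^-1 ^+ n.+1 = 2^-1 * q by rewrite exprS.
  have -> : 2 - 2 * (2^-1 * q) = (2 - 2 * q) + q by field.
  by rewrite [leRHS]mulrDr.
have xlim x (e : R) : 0 < e -> exists n, forall a, modulus (s x n a - g (x, a)) <= e.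
  move=> e0; have [|n ne] := @half_pow_small _ (4 * rnorm x) e _ e0.
    by rewrite mulr_ge0 ?rnorm_ge0.
  exists n => a; rewrite sE.
  exact: le_trans (gP (x, a) n) ne.
pose F x : J := LongJamesSpace p1 (long_James_limit (snorm x) (xlim x)).
have Fl : linear F.
  move=> z x y; apply: long_JamesE => a.
  rewrite long_James_addE long_James_scaleE -[LHS]/(g (z *: x + y, a)).
  rewrite -[F x a]/(g (x, a)) -[F y a]/(g (y, a)).
  apply/eqP; rewrite -subr_eq0; apply/eqP/modulus_small_eq0 => e e0.
  pose M := 4 * rnorm (z *: x + y) + (modulus z * (4 * rnorm x) + 4 * rnorm y).
  have M0 : 0 <= M.
    by rewrite !addr_ge0 ?mulr_ge0 ?rnorm_ge0 ?modulus_ge0.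
  have [n Mn] := half_pow_small M0 e0.
  apply: le_trans Mn.
  have -> : g (z *: x + y, a) - (z * g (x, a) + g (y, a)) =
      (g (z *: x + y, a) - \sum_(i < n) Z i (z *: x + y) a) +
      (z * (\sum_(i < n) Z i x a - g (x, a)) + (\sum_(i < n) Z i y a - g (y, a))).
    have -> : \sum_(i < n) Z i (z *: x + y) a =
        z * \sum_(i < n) Z i x a + \sum_(i < n) Z i y a.
      by rewrite mulr_sumr -big_split; apply: eq_bigr => i _; rewrite linearP.
    by ring.
  have -> : M * 2^-1 ^+ n = 4 * rnorm (z *: x + y) * 2^-1 ^+ n +
      (modulus z * (4 * rnorm x * 2^-1 ^+ n) + 4 * rnorm y * 2^-1 ^+ n).
    rewrite /M; move: (rnorm (z *: x + y)) (rnorm x) (rnorm y) (modulus z) (2^-1 ^+ n).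
    by move=> r1 r2 r3 r4 r5; ring.
  apply: le_trans (modulusD _ _) _; rewrite lerD//.
    by rewrite modulusB_sym; exact: gP (_, _) n.
  apply: le_trans (modulusD _ _) _; rewrite lerD//; last exact: gP (_, _) n.
  by rewrite modulusM ler_wpM2l ?modulus_ge0//; exact: gP (_, _) n.
have Fb : F \in bounded_linear J J.
  apply: (bop_bounded (C := 2)) => // x; apply: rnorm_le.
  exact: pvariation_limit (snorm x) (xlim x).
by exists (BoundedOperator Fb) => x a n; exact: gP (x, a) n.
Qed.

End Limits.

(** * Boundedness of the homomorphism *)

Section Homomorphism.
Context {R : realType} {k : scalar_kind} {p : R} {p1 : 1 < p}.
Context {d : Order.disp_t} {W : omega1Type d}.
Local Notation K := (scalar_field R k).
Local Notation J := (long_James_space k p1 W).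
Local Notation B := (bounded_operator J).
Implicit Types (S T : B) (x : J).

(** Here [z j] is composition with [pi j], and [w j] is composition with [tau j] minus composition
    with [tau j \o rho]. For i = j the subtracted term is the value of S n x at [rho a], a point of
    D, hence 0; for i != j the two terms cancel. *)
Lemma shift_operators (S : nat -> B) : (forall n, negligible (S n)) ->
  exists (z w : nat -> B) (f g : nat -> W -> W),
  [/\ forall j x, rnorm (z j x) <= rnorm x,
      forall j x a, w j x a = x (f j a) - x (g j a) &
      forall n i j x a, w j (z i (S n x)) a = if i == j then S n x a else 0].
Proof.
move=> Sn; pose D := [set a | forall n x, S n x a = 0].
have [|a la acc|rho [tau [pi [[rhoD rho_le rhoc rho_ge] tauP piP pi_tau tau_rho]]]] :=
    @copies_exist d W D.
- move=> a; have [b ab bD] := vanishing_unbounded Sn a.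
  by exists b.
(* D is closed by left continuity of the functions S n x. *)
- move=> n x; apply: modulus_small_eq0 => e e0.
  have [b ba bP] := long_James_left (S n x) e0 la.
  have [b' bb' b'a] := la.2 _ ba.
  have [c [Dc b'c ca]] := acc _ b'a.
  have := bP c (lt_le_trans bb' b'c) (ltW ca).
  by rewrite Dc sub0r -modulus_normr normrN modulus_normr.
have tau_le j : {homo tau j : a b / (a <= b)%O}.
  by move=> a b; rewrite le_eqVlt => /orP[/eqP->//|/(tauP j).1/ltW].
have tau_unb j : unbounded (tau j).
  by move=> a; exists a => c /lt_le_trans; apply; exact: lt_homo_ge (tauP j).1 c.
have taurho_le j : {homo tau j \o rho : a b / (a <= b)%O}.
  by move=> a b /rho_le /(tau_le j).
have taurho_unb j : unbounded (tau j \o rho).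
  move=> a; exists a => c ac; apply: lt_le_trans (lt_homo_ge (tauP j).1 _).
  exact: lt_le_trans ac (rho_ge c).
have taurho_cont j : continuous (tau j \o rho).
  by move=> a; apply: continuous_comp; [exact: rhoc|exact: (tauP j).2].
have pi_unb j : unbounded (pi j).
  move=> a; have [a' aa'] := omega1_unbounded a; exists (tau j a') => c /ltW ac.
  by apply: lt_le_trans aa' _; rewrite -(pi_tau j a'); exact: (piP j).1.
exists (fun j => composition (piP j).1 (piP j).2 (@pi_unb j)).
exists (fun j => composition (@tau_le j) (tauP j).2 (@tau_unb j) -
  composition (@taurho_le j) (@taurho_cont j) (@taurho_unb j)).
exists tau, (fun j => tau j \o rho).
split=> [j x|//|n i j x a]; first exact: rnorm_composition.
rewrite -[LHS]/(S n x (pi i (tau j a)) - S n x (pi i (tau j (rho a)))).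
case: eqVneq => [->|ij]; first by rewrite !pi_tau (rhoD a) subr0.
by rewrite -tau_rho 1?eq_sym// subrr.
Qed.

Context {A : normedAlgType K} (phi : {linear B -> A}).
Hypothesis phiM : forall S T, phi (amul S T) = amul (phi S) (phi T).

Definition anorm (v : A) : R := modulus `|v|.

Lemma anorm_ge0 v : 0 <= anorm v. Proof. exact: modulus_ge0. Qed.

Lemma anormD u v : anorm (u + v) <= anorm u + anorm v.
Proof.
apply: le_trans (modulusD _ _); apply: le_modulus.
by rewrite normr_id ger0_norm ?addr_ge0// ler_normD.
Qed.

Lemma anormZ (z : K) v : anorm (z *: v) = modulus z * anorm v.
Proof. by rewrite /anorm normrZ modulusM modulus_normr. Qed.

Lemma anormM u v : anorm (amul u v) <= anorm u * anorm v.
Proof.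
rewrite /anorm -modulusM; apply: le_modulus.
by rewrite normr_id ger0_norm ?mulr_ge0// amul_norm.
Qed.

(** A gliding hump: [w j] picks out the j-th summand of T, and this summand alone would force the
    norm of phi T above j. *)
Lemma phi_bounded_negligible : exists C : R, forall S, negligible S ->
  bnorm S <= 1 -> anorm (phi S) <= C.
Proof.
apply: contrapT => /forallNP unb.
have /choice[S SP] (n : nat) : exists S, [/\ negligible S, bnorm S <= 1 &
    n%:R < anorm (phi S)].
  apply: contrapT => /forallNP h; apply: (unb n%:R) => S nS S1.
  by rewrite leNgt; apply/negP => lt; apply: (h S).
have [z [w [f [g [zP wE wzP]]]]] := shift_operators (fun n => let: And3 h _ _ := SP n in h).
pose c j := anorm (phi (w j)).
(* The factor [2 ^+ j] offsets the coefficient of the j-th summand of T; [c j + 1] in place of [c j]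
   makes the final inequality strict. *)
have /choice[N NP] (j : nat) : exists N : nat, 2 ^+ j * (j%:R * (c j + 1)) <= N%:R.
  exists (Num.bound (2 ^+ j * (j%:R * (c j + 1)))); apply/ltW/archi_boundP.
  by rewrite !mulr_ge0 ?addr_ge0 ?exprn_ge0// anorm_ge0.
pose h j : K := of_real k (2^-1 ^+ j).
have hE j : modulus (h j) = 2^-1 ^+ j by rewrite modulus_of_real// exprn_ge0.
pose Z i := h i *: amul (z i) (S (N i)).
have ZE i x : Z i x = h i *: z i (S (N i) x) by [].
clearbody Z.
have [|T TP] := @operator_series _ _ _ _ _ _ Z.
  move=> i x; rewrite mulrC.
  have : rnorm (z i (S (N i) x)) <= rnorm x.
    apply: le_trans (zP _ _) _; apply: le_trans (rnorm_bop _ _) _.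
    by case: (SP (N i)) => _ S1 _; rewrite ler_piMl// rnorm_ge0.
  by rewrite ZE rnormZ hE => /ler_wpM2l; apply; exact: exprn_ge0.
have wT j : amul (w j) T = h j *: S (N j).
  apply: bopP => x; apply: long_JamesE => a.
  rewrite -[LHS]/(w j (T x) a) bopZE long_James_scaleE wE.
  apply/eqP; rewrite -subr_eq0; apply/eqP/modulus_small_eq0 => e e0.
  have [|n ne] := @half_pow_small _ (4 * rnorm x + 4 * rnorm x) e _ e0.
    by rewrite addr_ge0// mulr_ge0// rnorm_ge0.
  (* More than j terms, so that the j-th one occurs, and at least n, for the error bound. *)
  pose m := (n + j.+1)%N.
  have partial : h j * S (N j) x a =
      \sum_(i < m) Z i x (f j a) - \sum_(i < m) Z i x (g j a).
    have jm : (j < m)%N by rewrite /m addnS ltnS leq_addl.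
    rewrite -sumrB (bigD1 (Ordinal jm))//= big1 => [|i ij].
      by rewrite addr0 !ZE !long_James_scaleE -mulrBr -wE wzP eqxx.
    rewrite !ZE !long_James_scaleE -mulrBr -wE wzP; case: eqVneq => [ei|_]; last by rewrite mulr0.
    by move: ij; rewrite -val_eqE/= ei eqxx.
  have mn : 2^-1 ^+ m <= 2^-1 ^+ n :> R.
    by rewrite /m exprD ler_piMr ?exprn_ge0// exprn_ile1// invf_le1// ler1n.
  have TPm b : modulus (\sum_(i < m) Z i x b - T x b) <= 4 * rnorm x * 2^-1 ^+ n.
    by apply: le_trans (TP _ _ _) _; rewrite ler_wpM2l// mulr_ge0// rnorm_ge0.
  rewrite partial.
  have -> : T x (f j a) - T x (g j a) -
      (\sum_(i < m) Z i x (f j a) - \sum_(i < m) Z i x (g j a)) =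
      (T x (f j a) - \sum_(i < m) Z i x (f j a)) +
      (\sum_(i < m) Z i x (g j a) - T x (g j a)) by ring.
  apply: le_trans (modulusD _ _) _; apply: le_trans ne; rewrite [leRHS]mulrDl.
  by rewrite lerD// modulusB_sym.
have [j tj] : exists j : nat, anorm (phi T) < j%:R.
  by exists (Num.bound (anorm (phi T))); apply: archi_boundP; exact: anorm_ge0.
have : anorm (phi (amul (w j) T)) <= c j * anorm (phi T).
  by rewrite phiM; exact: anormM.
rewrite wT linearZ anormZ hE.
have [_ _ big] := SP (N j).
apply/negP; rewrite -ltNge.
apply: (@lt_le_trans _ _ (j%:R * (c j + 1))).
  rewrite mulrDr mulr1 [_ * c j]mulrC; apply: le_lt_trans (_ : c j * j%:R < _).
    by rewrite ler_wpM2l ?anorm_ge0// ltW.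
  by rewrite ltrDl (le_lt_trans _ tj)// anorm_ge0.
rewrite exprVn ler_pdivlMl ?exprn_gt0//.
exact: le_trans (NP j) (ltW big).
Qed.

Lemma bnormD S T : bnorm (S + T) <= bnorm S + bnorm T.
Proof.
apply: le_trans (modulusD _ _); apply: le_modulus.
by rewrite normr_id ger0_norm ?addr_ge0// ler_normD.
Qed.

Lemma bnormZ (z : K) S : bnorm (z *: S) = modulus z * bnorm S.
Proof. by rewrite /bnorm normrZ modulusM modulus_normr. Qed.

Lemma negligibleZ (z : K) S : negligible S -> negligible (z *: S).
Proof.
move=> [a aP]; exists a => b /aP[c cP]; exists c => e /cP Se.
by rewrite bopZE long_James_scaleE Se mulr0.
Qed.

(** Each S in the unit ball is a multiple of the identity by a scalar of modulus at most 2, plus a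
    negligible operator of bounded norm; phi is bounded on both parts. *)
Lemma phi_continuous : continuous phi.
Proof.
have [C CP] := phi_bounded_negligible.
pose I := bnorm (idop : B).
have I0 : 0 <= I by exact: bnorm_ge0.
(* This bounds the norm of [S - z *: idop] when S has norm at most 1 and z has modulus at most 2. *)
pose M := 1 + 2 * I.
have M0 : 0 < M by rewrite ltr_pwDl// mulr_ge0.
pose C' := M * C + 2 * anorm (phi idop).
have bounded S : bnorm S <= 1 -> anorm (phi S) <= C'.
  move=> S1; have [z [z2 nS]] := scalar_plus_negligible S.
  have {}z2 : modulus z <= 2 by rewrite (le_trans z2)// ler_piMl.
  have [S' [nS' S'1 SE]] : exists S', [/\ negligible S', bnorm S' <= 1 &
      S = of_real k M *: S' + z *: idop].
    exists (of_real k M^-1 *: (S - z *: idop)); split; first exact: negligibleZ.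
      rewrite bnormZ modulus_of_real ?invr_ge0 ?(ltW M0)// ler_pdivrMl// mulr1.
      apply: le_trans (bnormD _ _) _; rewrite -scaleNr bnormZ lerD//.
      by rewrite -modulus_normr normrN modulus_normr ler_wpM2r.
    by rewrite scalerA -of_realM mulfV ?gt_eqF// of_real1 scale1r subrK.
  rewrite SE linearD 2!linearZ; apply: le_trans (anormD _ _) _.
  rewrite !anormZ modulus_of_real ?(ltW M0)//.
  by rewrite lerD ?ler_wpM2l ?ler_wpM2r ?anorm_ge0 ?(ltW M0) ?CP.
apply: bounded_linear_continuous; apply/ex_bound; exists (of_real k C').
apply/nbhs_norm0P; exists 1 => //= S /ltW S1.
rewrite /= -[leLHS]normr_id -of_real_modulus of_real_le bounded//.
by rewrite -(of_real_le (k := k)) of_real_modulus normr_id of_real1.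
Qed.

End Homomorphism.

Theorem theorem3p12 (R : realType) (k : scalar_kind) (p : R) (p1 : 1 < p)
  (d : Order.disp_t) (W : omega1Type d) (A : banachAlgType (scalar_field R k))
  (phi : {linear bounded_operator (long_James_space k p1 W) -> A})
  (phiM : forall S T, phi (amul S T) = amul (phi S) (phi T)) :
  continuous phi.
Proof. exact: phi_continuous. Qed.
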